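(* Let $d\ge 1$ be an integer, $\mu>-\tfrac12$, $\alpha=\mu+\frac{d-1}{2}$, let $n,n'\ge 0$ be integers and $N=\max\{n,n'\}$, and let $p,q$ be real with $p>2N+2\mu+d$ and $q>-2\mu-d$. For each $m\ge 0$ let $\{P_{\mathbf k}^m:\ |\mathbf k|=m,\ \mathbf k\in\mathbb N_0^d\}$ be an orthonormal basis of $\mathcal V_m^d(\mathbb B^d,\mathsf w_\mu)$, and for $|\mathbf k|=m$, $0\le m\le n$ define $$M_{\mathbf k,n}^{(p,q,\mu)}(x,t)=M_{n-m}^{(p-2\alpha-2m,\;q+2\alpha+2m)}(t)\;t^m P_{\mathbf k}^m\!\left(\frac{x}{t}\right).$$ Then $\{M_{\mathbf k,n}^{(p,q,\mu)}:\ |\mathbf k|=m,\ 0\le m\le n\}$ is an orthogonal basis of $\mathcal V_n(\mathbb V^{d+1},W_{p,q,\mu})$, and for $|\mathbf k|=m$, $0\le m\le n$, $|\mathbf k'|=m'$, $0\le m'\le n'$, $$\left\langle M_{\mathbf k,n}^{(p,q,\mu)},M_{\mathbf k',n'}^{(p,q,\mu)}\right\rangle_{p,q,\mu}=H_{m,n}^{(p,q,\mu)}\,\delta_{n,n'}\delta_{m,m'}\delta_{\mathbf k,\mathbf k'},$$ where $$H_{m,n}^{(p,q,\mu)}=\frac{c_{p-2\alpha,\,q+2\alpha}}{c_{p-2\alpha-2m,\,q+2\alpha+2m}}\;h_{n-m}^{(p-2\alpha-2m,\,q+2\alpha+2m)}.$$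
   Context: Univariate polynomials: $M_n^{(p,q)}(x)=(-1)^n\frac{(1+x)^{p+q}}{x^q}\frac{d^n}{dx^n}\left(x^{n+q}(1+x)^{n-p-q}\right)$, a polynomial of degree at most $n$ in $x$. Constants: $c_{p,q}=\frac{\Gamma(p+q)}{\Gamma(p-1)\Gamma(q+1)}$ for $p>1$, $q>-1$ (so $c_{p,q}\int_0^\infty \frac{x^q}{(1+x)^{p+q}}dx=1$), and $h_n^{(p,q)}=\frac{n!\,(p-n-1)!\,(p+q-1)!\,(q+1)_n}{(p-2)!\,(p-2n-1)\,(p+q-n-1)!}$, where $z!$ means $\Gamma(z+1)$ and $(a)_n=a(a+1)\cdots(a+n-1)$ with $(a)_0=1$. Unit ball: $\mathbb B^d=\{x\in\mathbb R^d:\|x\|\le1\}$, $\mathsf w_\mu(x)=(1-\|x\|^2)^{\mu-1/2}$, with inner product $\langle f,g\rangle_\mu=b_\mu^{\mathbb B}\int_{\mathbb B^d}fg\,\mathsf w_\mu\,dx$, $b_\mu^{\mathbb B}=\frac{\Gamma(\mu+\frac{d+1}{2})}{\pi^{d/2}\Gamma(\mu+\frac12)}$ (so $\langle1,1\rangle_\mu=1$). $\mathcal V_m^d(\mathbb B^d,\mathsf w_\mu)$ is the space of polynomials of degree at most $m$ in $d$ variables orthogonal to all polynomials of degree less than $m$; it has dimension $\binom{m+d-1}{m}$, and orthonormality is with respect to $\langle\cdot,\cdot\rangle_\mu$. For $P$ of degree at most $m$, $t^mP(x/t)$ is regarded as the corresponding homogeneous polynomial of degree $m$ in $(x,t)$.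 Solid cone: $\mathbb V^{d+1}=\{(x,t):\|x\|\le t,\ x\in\mathbb R^d,\ 0\le t<\infty\}$, $W_{p,q,\mu}(x,t)=(t^2-\|x\|^2)^{\mu-\frac12}\frac{t^q}{(1+t)^{p+q}}$, and $\langle f,g\rangle_{p,q,\mu}=b_{p,q,\mu}^M\int_{\mathbb V^{d+1}}f(x,t)g(x,t)W_{p,q,\mu}(x,t)\,dx\,dt$ with $b_{p,q,\mu}^M=b_\mu^{\mathbb B}\,c_{p-2\mu-d+1,\,q+2\mu+d-1}$. $\mathcal V_n(\mathbb V^{d+1},W_{p,q,\mu})$ is the space of polynomials of degree at most $n$ in the $d+1$ variables $(x,t)$ orthogonal, with respect to $\langle\cdot,\cdot\rangle_{p,q,\mu}$, to all polynomials of degree less than $n$. *)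

(* Defs.v *)
From HB Require Import structures.
From mathcomp Require Import all_boot all_order all_algebra.
From mathcomp Require Import ring.
From mathcomp Require Import -(notations) mpoly.
From mathcomp Require Import all_classical all_reals all_analysis.
Set Implicit Arguments.
Unset Strict Implicit.
Unset Printing Implicit Defensive.
Import Order.TTheory GRing.Theory Num.Theory.
Import numFieldNormedType.Exports.
Local Open Scope classical_set_scope.
Local Open Scope ring_scope.

(* The notations of mpoly clash with those of MathComp-Analysis, so mpoly is
   imported without them and only these two are restored. *)
Notation "{ 'mpoly' T [ n ] }" := (mpoly n T) (at level 0, T at level 2,
  format "{ 'mpoly'  T [ n ] }").
Notation "p .@[ v ]" := (meval v p) (at level 2) : ring_scope.

Definition snoc (T : Type) (d : nat) (z : d.-tuple T * T) : d.+1.-tuple T :=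
  [tuple of rcons z.1 z.2].

Section lebesgue_tuple.
Variable R : realType.
Let RT := measurableTypeR R.

Lemma measurable_snoc (d : nat) : measurable_fun setT (@snoc RT d).
Proof.
apply/measurable_fun_tnthP => i.
case: (ltnP i d) => id.
- rewrite [X in measurable_fun _ X](_ : _ = (fun x => tnth x (Ordinal id)) \o fst).
    by apply: measurableT_comp => //; exact: measurable_tnth.
  by apply/funext => -[x t] /=; rewrite (tnth_nth t)/= nth_rcons size_tuple id (tnth_nth t).
- rewrite [X in measurable_fun _ X](_ : _ = snd) //.
  apply/funext => -[x t] /=; rewrite (tnth_nth t)/= nth_rcons size_tuple ltnNge id /=.
  by case: eqP.
Qed.

Section snoc_measure.
Context (d : nat) (m : {measure set (d.-tuple RT) -> \bar R}).

Definition snoc_measure := pushforward (m \x lebesgue_measure)%E (@snoc RT d).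

HB.instance Definition _ := Measure.copy snoc_measure
  (measure_function_pushforward__canonical__measure_function_Measure
    (m \x lebesgue_measure)%E (@measurable_snoc d)).

End snoc_measure.

(* Lebesgue measure on R^n, for the n-fold product sigma-algebra. *)
Fixpoint lebesgue_tuple (n : nat) : {measure set (n.-tuple RT) -> \bar R} :=
  match n with
  | 0 => \d_[tuple]
  | d.+1 => snoc_measure (lebesgue_tuple d)
  end.

End lebesgue_tuple.
Arguments lebesgue_tuple {R} n.

Section special_functions.
Context {R : realType}.
Implicit Types (p q z a mu : R) (m n d : nat).

(* Euler's integral, which converges for z > 0 only. *)
Definition Gamma z : R :=
  \int[lebesgue_measure]_(t in `]0, +oo[) (t `^ (z - 1) * expR (- t)).

Definition rfact z : R := Gamma (z + 1).

Definition pochhammer a n : R := \prod_(i < n) (a + i%:R).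

Definition c_ p q : R := Gamma (p + q) / (Gamma (p - 1) * Gamma (q + 1)).

Definition h_ n p q : R :=
  (n`!%:R * rfact (p - n%:R - 1) * rfact (p + q - 1) * pochhammer (q + 1) n) /
  (rfact (p - 2) * (p - 2 * n%:R - 1) * rfact (p + q - n%:R - 1)).

Definition rodrigues n p q (x : R) : R :=
  (-1) ^+ n * ((1 + x) `^ (p + q) / x `^ q) *
  derive1n n (fun y : R => y `^ (n%:R + q) * (1 + y) `^ (n%:R - p - q)) x.

Lemma rodrigues_poly n p q :
  exists M : {poly R}, forall x : R, 0 < x -> M.[x] = rodrigues n p q x.
Proof.
pose F k (Q : {poly R}) (x : R) :=
  x `^ (n%:R + q - k%:R) * (1 + x) `^ (n%:R - p - q - k%:R) * Q.[x].
suff [Q HQ] : exists Q : {poly R}, forall x : R, 0 < x ->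
    derive1n n (fun y : R => y `^ (n%:R + q) * (1 + y) `^ (n%:R - p - q)) x = F n Q x.
  exists ((-1) ^+ n *: Q) => x x0; rewrite hornerZ /rodrigues HQ// /F.
  have x10 : 0 < 1 + x by rewrite addr_gt0.
  rewrite -[in LHS](mul1r Q.[x]) -!mulrA; congr (_ * _); rewrite !mulrA; congr (_ * _).
  rewrite addrAC subrr add0r (_ : n%:R - p - q - n%:R = - (p + q)); last by ring.
  by rewrite powRN; field; rewrite !gt_eqF ?powR_gt0.
suff: forall k, exists Q : {poly R}, forall x : R, 0 < x ->
    derive1n k (fun y : R => y `^ (n%:R + q) * (1 + y) `^ (n%:R - p - q)) x = F k Q x.
  by move=> /(_ n).
elim=> [|k [Q HQ]].
  by exists 1 => x x0; rewrite /F !subr0 hornerC mulr1.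
set a := n%:R + q in HQ *; set b := n%:R - p - q in HQ *.
exists ((a - k%:R) *: ((1 + 'X) * Q) + (b - k%:R) *: ('X * Q) + 'X * (1 + 'X) * Q^`()) => x x0.
have x10 : 0 < 1 + x by rewrite addr_gt0.
rewrite /= derive1E.
rewrite (@near_eq_derive _ _ _ _ (F k Q)) ?oner_eq0//; last first.
  by near=> z; apply: HQ; near: z; exact: lt_nbhsr.
rewrite /F -/a -/b.
have pa : x `^ (a - k%:R) = x * x `^ (a - k.+1%:R).
  by rewrite -[X in X * _]powRr1 ?ltW// -powRD ?(gt_eqF x0) ?implybT// -natr1; congr (_ `^ _); ring.
have pb : (1 + x) `^ (b - k%:R) = (1 + x) * (1 + x) `^ (b - k.+1%:R).
  rewrite -[X in X * _]powRr1 ?ltW// -powRD ?(gt_eqF x10) ?implybT// -natr1; congr (_ `^ _); ring.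
have d1 : is_derive x 1 (fun y : R => y `^ (a - k%:R)) ((a - k%:R) * x `^ (a - k%:R - 1)).
  exact: is_derive1_powR.
have d2 : is_derive x 1 (fun y : R => (1 + y) `^ (b - k%:R)) ((b - k%:R) * (1 + x) `^ (b - k%:R - 1)).
  have d3 : is_derive (1 + x) 1 (fun y : R => y `^ (b - k%:R)) ((b - k%:R) * (1 + x) `^ (b - k%:R - 1)).
    exact: is_derive1_powR.
  have d4 : is_derive x 1 (fun y : R => 1 + y) 1.
    by rewrite -[X in is_derive _ _ _ X]add0r; apply: is_deriveD.
  have := @is_derive1_comp _ (fun y : R => y `^ (b - k%:R)) (fun y : R => 1 + y) x _ _ d3 d4.
  by rewrite mulr1.
have d5 : is_derive x 1 (horner Q) Q^`().[x] by exact: is_derive_poly.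
have /(@derive_val _ _ _ _ _ _ _) := is_deriveM (is_deriveM d1 d2) d5.
rewrite /GRing.scale /= => E; etransitivity; first exact: E.
rewrite !(hornerD, hornerZ, hornerM, hornerX, hornerC) ?pa ?pb (_ : a - k%:R - 1 = a - k.+1%:R); last by rewrite -natr1; ring.
rewrite (_ : b - k%:R - 1 = b - k.+1%:R); last by rewrite -natr1; ring.
rewrite mulrfctE ?pa ?pb. ring.
Unshelve. all: by end_near.
Qed.

(* The right-hand side of Rodrigues' formula makes sense for x > 0 only; M_ is
   the polynomial that it defines there (see M_E and M_unique). *)
Definition M_ n p q : {poly R} :=
  xget 0 [set M : {poly R} | forall x : R, 0 < x -> M.[x] = rodrigues n p q x].

Lemma M_E n p q (x : R) : 0 < x -> (M_ n p q).[x] = rodrigues n p q x.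
Proof. exact: (xgetPex 0 (rodrigues_poly n p q)). Qed.

Lemma M_unique n p q (M : {poly R}) :
  (forall x : R, 0 < x -> M.[x] = rodrigues n p q x) -> M = M_ n p q.
Proof.
move=> MR; apply/eqP; rewrite -subr_eq0; apply/negP => /negP M0.
have /(max_poly_roots M0) : all (root (M - M_ n p q)) [seq k.+1%:R | k <- iota 0 (size (M - M_ n p q))].
  by apply/allP => _ /mapP[k _ ->]; rewrite /root hornerD hornerN MR// M_E// subrr.
rewrite size_map size_iota ltnn map_inj_uniq ?iota_uniq; first by move/(_ isT).
by move=> i j /eqP; rewrite eqr_nat => /eqP[].
Qed.

End special_functions.

Section homogenization.
Context {R : realType}.

(* The homogeneous polynomial t^m P(x/t) of degree m in (x, t), for P of degree
   at most m: the monomial x^k becomes x^k t^(m - |k|). *)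
Definition homogenize (d m : nat) (P : {mpoly R[d]}) : {mpoly R[d.+1]} :=
  \sum_(k <- msupp P)
    mcoeff k P *: mpolyX R (Multinom [tuple of rcons k (m - mdeg k)%N]).

Lemma homogenizeE (d m : nat) (P : {mpoly R[d]}) (x : d.-tuple R) (t : R) :
  (msize P <= m.+1)%N -> t != 0 ->
  (homogenize m P).@[tnth (snoc (x, t))] =
  t ^+ m * P.@[fun i => tnth x i / t].
Proof.
move=> Pm t0; rewrite [P in RHS]mpolyE /homogenize !raddf_sum/= mulr_sumr.
rewrite !big_seq; apply: eq_bigr => k kP; rewrite !mevalZ !mevalX mulrCA; congr (_ * _).
have km : (mdeg k <= m)%N by rewrite -ltnS (leq_trans _ Pm)// msize_mdeg_lt.
rewrite big_ord_recr/= (_ : tnth _ ord_max = t); last first.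
  by rewrite (tnth_nth t)/= nth_rcons size_tuple ltnn eqxx.
rewrite [X in _ * t ^+ X](_ : _ = (m - mdeg k)%N); last first.
  by rewrite multinomE (tnth_nth 0%N)/= nth_rcons size_tuple ltnn eqxx.
under [in RHS]eq_bigr do rewrite exprMn exprVn.
rewrite big_split/= prodfV -expr_sum -mdegE mulrCA; congr (_ * _).
  apply: eq_bigr => i _; congr (_ ^+ _).
    by rewrite !(tnth_nth t)/= nth_rcons size_tuple ltn_ord.
  by rewrite multinomE mnm_tnth !(tnth_nth 0%N)/= nth_rcons size_tuple ltn_ord.
by rewrite expfB_cond// (negbTE t0).
Qed.

End homogenization.

Section orthogonality.
Context {R : realType} (k : nat).
Variable ip : {mpoly R[k]} -> {mpoly R[k]} -> \bar R.

(* msize is one more than the total degree, and 0 for the zero polynomial. *)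
Definition orthopoly_space (m : nat) : set {mpoly R[k]} :=
  [set f | (msize f <= m.+1)%N /\
           forall g : {mpoly R[k]}, (msize g <= m)%N -> ip f g = 0%E].

Variables (I : finType) (A : pred I) (b : I -> {mpoly R[k]}).

Definition is_basis (S : set {mpoly R[k]}) : Prop :=
  [/\ forall i, A i -> S (b i),
      forall c : I -> R, \sum_(i | A i) c i *: b i = 0 ->
        forall i, A i -> c i = 0 &
      forall f, S f -> exists c : I -> R, f = \sum_(i | A i) c i *: b i].

Definition is_orthogonal_basis (S : set {mpoly R[k]}) : Prop :=
  is_basis S /\
  forall i j, A i -> A j -> i != j -> ip (b i) (b j) = 0%E.

Definition is_orthonormal_basis (S : set {mpoly R[k]}) : Prop :=
  is_basis S /\
  forall i j, A i -> A j -> ip (b i) (b j) = ((i == j)%:R)%:E.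

End orthogonality.

(* Inner products are extended-real valued, so that an equation between an
   inner product and a real number includes the convergence of the integral. *)
Section ball_and_cone.
Context {R : realType}.
Implicit Types (p q mu : R) (m n d : nat).

Definition sqnorm d (x : d.-tuple R) : R := \sum_(i < d) tnth x i ^+ 2.

Definition ball_set d : set (d.-tuple (measurableTypeR R)) :=
  [set x | Num.sqrt (sqnorm x) <= 1].

Definition ball_weight d mu (x : d.-tuple R) : R :=
  (1 - sqnorm x) `^ (mu - 2^-1).

Definition b_ball d mu : R :=
  Gamma (mu + (d%:R + 1) / 2) / (pi `^ (d%:R / 2) * Gamma (mu + 2^-1)).

Definition ball_ip d mu (f g : {mpoly R[d]}) : \bar R :=
  ((b_ball d mu)%:E *
   \int[lebesgue_tuple d]_(x in @ball_set d)
     (f.@[tnth x] * g.@[tnth x] * ball_weight mu x)%:E)%E.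

Definition cone_set d :
    set (d.-tuple (measurableTypeR R) * measurableTypeR R) :=
  [set z | Num.sqrt (sqnorm z.1) <= z.2].

Definition cone_weight d p q mu (x : d.-tuple R) (t : R) : R :=
  (t ^+ 2 - sqnorm x) `^ (mu - 2^-1) * (t `^ q / (1 + t) `^ (p + q)).

Definition b_cone d p q mu : R :=
  b_ball d mu *
  c_ (p - 2 * mu - d%:R + 1) (q + 2 * mu + d%:R - 1).

Definition cone_ip d p q mu (f g : {mpoly R[d.+1]}) : \bar R :=
  ((b_cone d p q mu)%:E *
   \int[lebesgue_tuple d \x lebesgue_measure]_(z in @cone_set d)
     (f.@[tnth (snoc z)] * g.@[tnth (snoc z)] *
      cone_weight p q mu z.1 z.2)%:E)%E.

Definition alpha_ d mu : R := mu + (d%:R - 1) / 2.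

Definition tvar d : {mpoly R[d.+1]} := mpolyX R (mnm1 ord_max).

(* M_{k,n}, with m = |k| *)
Definition coneM d p q mu (P : multinom d -> {mpoly R[d]}) n (k : multinom d) :
    {mpoly R[d.+1]} :=
  let m := mdeg k in
  let a := alpha_ d mu in
  horner_alg (tvar d)
    (M_ (n - m) (p - 2 * a - 2 * m%:R) (q + 2 * a + 2 * m%:R)) *
  homogenize m (P k).

Definition H_ d p q mu m n : R :=
  let a := alpha_ d mu in
  c_ (p - 2 * a) (q + 2 * a) /
  c_ (p - 2 * a - 2 * m%:R) (q + 2 * a + 2 * m%:R) *
  h_ (n - m) (p - 2 * a - 2 * m%:R) (q + 2 * a + 2 * m%:R).

End ball_and_cone.

(* Main.v *)
From HB Require Import structures.
Require Import Defs.
From mathcomp Require Import all_boot all_order all_algebra.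
From mathcomp Require Import ring lra zify.
From mathcomp Require Import -(notations) mpoly.
From mathcomp Require Import all_classical all_reals all_analysis.
From mathcomp Require Import measurable_realfun.
Set Implicit Arguments.
Unset Strict Implicit.
Unset Printing Implicit Defensive.
Import Order.TTheory GRing.Theory Num.Theory.
Import numFieldNormedType.Exports.
Local Open Scope classical_set_scope.
Local Open Scope ring_scope.

(** Slicing the cone at height t and substituting x = t y turns
    <M_{k,n}, M_{k',n'}> into the product of the ball inner product of P_k and
    P_k', which is the Kronecker delta (so the value of b_ball never matters),
    and of the integral over t > 0 of M_{n-m} M_{n'-m'} times a power weight
    t^q' / (1+t)^(p'+q').  For m = m' the latter is the orthogonality relation
    of the univariate polynomials: integrating by parts n times in Rodrigues'
    formula leaves n! times a leading coefficient times a Beta integral.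

    Boundary terms are avoided altogether: on monomials the integration by
    parts rule is an identity between Beta integrals, a consequence of
    Gamma(z+1) = z Gamma(z).  Gamma(a) Gamma(b) = Gamma(a+b) B(a,b) and the
    recurrence of Gamma come from Tonelli's theorem and linear substitutions.

    Finally the M_{k,j} with |k| <= j <= n are as many as the monomials of
    degree at most n in d+1 variables and have nonzero norms, so they span all
    polynomials of degree at most n; orthogonality to the lower degrees singles
    out those with j = n. *)

(** * Gamma and Beta integrals *)

Section dilation.
Context {R : realType}.
Local Notation leb := (@lebesgue_measure R).
Local Open Scope ereal_scope.

Let dil (c : R) : measurableTypeR R -> measurableTypeR R := *%R c.

Let mdil (c : R) : measurable_fun setT (dil c).
Proof. exact: mulrl_measurable. Qed.

(** Uniqueness of Lebesgue measure: [c] times its image under the dilation is again a measure, and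
    it has the right value on half-open intervals. *)
Lemma lebesgue_measure_dilation (c : R) (A : set (measurableTypeR R)) :
  (0 < c)%R -> measurable A -> c%:E * leb (dil c @^-1` A) = leb A.
Proof.
move=> c0 mA.
pose pf : {measure set (measurableTypeR R) -> \bar R} := measure_function_pushforward__canonical__measure_function_Measure leb (mdil c).
pose m : {measure set (measurableTypeR R) -> \bar R} := mscale (NngNum (ltW c0)) pf.
rewrite -[LHS]/(m A); apply/esym.
apply: (lebesgue_measure_unique (mu := m)) => // _ [[a b]] _ <-.
rewrite -[RHS]/(c%:E * leb (dil c @^-1` `]a, b]%classic)).
rewrite (_ : dil c @^-1` `]a, b]%classic = `](a / c)%R, (b / c)%R]%classic); last first.
  by apply/seteqP; split => x /=; rewrite !in_itv/= /dil ltr_pdivrMr// ler_pdivlMr// mulrC.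
rewrite !lebesgue_measure_itv /= !lte_fin ltr_pM2r ?invr_gt0//.
case: ifPn => _; last by rewrite mule0.
by rewrite -!EFinD -EFinM; congr EFin; field; rewrite gt_eqF.
Qed.

Lemma ge0_integral_dilation (c : R) (f : measurableTypeR R -> \bar R) :
  (0 < c)%R -> measurable_fun [set: _] f -> (forall x, 0 <= f x) ->
  \int[leb]_x f x = c%:E * \int[leb]_x f (c * x)%R.
Proof.
move=> c0 mf f0.
pose pf : {measure set (measurableTypeR R) -> \bar R} := measure_function_pushforward__canonical__measure_function_Measure leb (mdil c).
pose m : {measure set (measurableTypeR R) -> \bar R} := mscale (NngNum (ltW c0)) pf.
transitivity (\int[m]_x f x).
  apply: eq_measure_integral => A mA _; exact/esym/lebesgue_measure_dilation.
rewrite ge0_integral_mscale//; congr (_ * _).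
by rewrite ge0_integral_pushforward// => x _.
Qed.

Lemma ge0_integral_pos_dilation (c : R) (f : measurableTypeR R -> \bar R) :
  (0 < c)%R -> measurable_fun setT f -> (forall x, 0 <= f x) ->
  \int[leb]_(x in `]0%R, +oo[) f x = c%:E * \int[leb]_(x in `]0%R, +oo[) f (c * x)%R.
Proof.
move=> c0 mf f0; rewrite integral_mkcond (ge0_integral_dilation c0)//.
- rewrite [in RHS]integral_mkcond; congr (_ * _); apply: eq_integral => x _.
  by rewrite !patchE !mem_setE !in_itv/= !andbT pmulr_rgt0.
- by apply/measurable_restrict => //; rewrite setTI; exact: measurable_funS mf.
- by move=> x; rewrite patchE; case: ifP.
Qed.

(** Tonelli's theorem for the function cut off outside the rectangle [A] x [B]. *)
Lemma ge0_integral_swap (A B : set (measurableTypeR R)) (f : measurableTypeR R * measurableTypeR R -> \bar R) :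
  measurable A -> measurable B -> measurable_fun setT f -> (forall x, 0 <= f x) ->
  \int[leb]_(x in A) \int[leb]_(y in B) f (x, y) =
  \int[leb]_(y in B) \int[leb]_(x in A) f (x, y).
Proof.
move=> mA mB mf f0.
pose g := f \_ (A `*` B).
have := @fubini_tonelli _ _ _ _ R leb leb g.
rewrite (_ : \int[_]_x _ = \int[leb]_(x in A) \int[leb]_(y in B) f (x, y)); last first.
  rewrite [RHS]integral_mkcond; apply: eq_integral => x _.
  rewrite [RHS]patchE; case: ifPn => xA; last first.
    apply: integral0_eq => y _.
    rewrite /g patchE ifF//; apply/negP => /set_mem[/= Ax By].
    by move/negP: xA; apply; exact/mem_set.
  rewrite [RHS]integral_mkcond; apply: eq_integral => y _.
  rewrite /g !patchE; congr (if _ then _ else _).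
  by rewrite in_setX xA.
rewrite (_ : (\int[leb]_y _ = \int[leb]_(y in B) \int[leb]_(x in A) f (x, y))); last first.
  rewrite [RHS]integral_mkcond; apply: eq_integral => y _.
  rewrite [RHS]patchE; case: ifPn => yB; last first.
    apply: integral0_eq => x _.
    rewrite /g patchE ifF//; apply/negP => /set_mem[/= Ax By].
    by move/negP: yB; apply; exact/mem_set.
  rewrite [RHS]integral_mkcond; apply: eq_integral => x _.
  rewrite /g !patchE; congr (if _ then _ else _).
  by rewrite in_setX yB andbT.
apply.
- apply/measurable_restrict => //; first exact: measurableX.
  by rewrite setTI; exact: measurable_funS mf.
- by move=> x; rewrite /g patchE; case: ifP.
Qed.

End dilation.

(** * Euler's integral: recurrence, finiteness, positivity, and the Beta integral *)

Section gamma_function.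
Context {R : realType}.
Local Notation leb := (@lebesgue_measure R).
Implicit Types a b c z s t : R.
Local Open Scope ereal_scope.

(** Euler's integral before it is truncated to a real number. Tonelli's theorem and substitutions
    apply to it without any convergence question; [eGammaK] returns to [Gamma]. *)
Definition eGamma z : \bar R :=
  \int[leb]_(t in `]0%R, +oo[) (t `^ (z - 1) * expR (- t))%:E.

Lemma eGamma_ge0 z : 0 <= eGamma z.
Proof. by apply: integral_ge0 => t _; rewrite lee_fin mulr_ge0 ?powR_ge0 ?expR_ge0. Qed.

Lemma eGamma_scale z c : (0 < c)%R ->
  \int[leb]_(t in `]0%R, +oo[) (t `^ (z - 1) * expR (- (c * t)))%:E =
  (c `^ (- z))%:E * eGamma z.
Proof.
move=> c0; rewrite /eGamma [in RHS](ge0_integral_pos_dilation c0); last 2 first.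
- apply/measurable_EFinP; apply: measurable_funM.
    exact: measurable_powR.
  by apply: measurableT_comp => //; exact: measurableT_comp.
- by move=> x; rewrite lee_fin mulr_ge0 ?powR_ge0 ?expR_ge0.
rewrite muleA -EFinM -ge0_integralZl_EFin//; last 3 first.
- by move=> x _; rewrite lee_fin mulr_ge0 ?powR_ge0 ?expR_ge0.
- apply/measurable_EFinP; apply: measurable_funTS; apply: measurable_funM => /=.
    apply: (@measurableT_comp _ _ _ _ _ _ (@powR R ^~ (z - 1)%R) _ (fun x => c * x)%R).
      exact: measurable_powR.
    exact: mulrl_measurable.
  by apply: measurableT_comp => //; apply: measurableT_comp.
- by rewrite mulr_ge0 ?powR_ge0// ltW.
apply: eq_integral => t; rewrite inE/= in_itv/= andbT => t0.
rewrite -EFinM; congr EFin.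
rewrite powRM ?ltW// !mulrA; congr (_ * _)%R.
rewrite -{2}(powRr1 (ltW c0)) -!powRD ?(gt_eqF c0) ?implybT//.
by rewrite [X in (c `^ X)%R](_ : _ = 0)%R ?powRr0 ?mul1r//; ring.
Qed.

Lemma integral_powRN z : (0 < z)%R ->
  \int[leb]_(u in `[1%R, +oo[) (u `^ (- z - 1))%:E = (z^-1)%:E.
Proof.
move=> z0.
pose F u : R := (- z^-1 * u `^ (- z))%R.
have dF (x : R) : (0 < x)%R -> is_derive x 1%R F (x `^ (- z - 1))%R.
  move=> x0.
  have H := @is_deriveZ _ _ _ _ (- z^-1)%R _ _ _ (@is_derive1_powR R (- z)%R x x0).
  (* Displays the derivative in the unsimplified form that [is_deriveZ] produces. *)
  rewrite (_ : (x `^ (- z - 1))%R = - z^-1 *: (- z * x `^ (- z - 1)))%R; first exact: H.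
  by rewrite /GRing.scale/=; field; rewrite gt_eqF.
rewrite (@ge0_continuous_FTC2y R _ F 1%R 0%R).
- by rewrite /F powR1 mulr1 -EFinN -EFinD sub0r opprK.
- by move=> x _; exact: powR_ge0.
- apply: derivable_within_continuous => x; rewrite in_itv/= andbT => x1.
  have x0 : (0 < x)%R by rewrite (lt_le_trans _ x1).
  by have [] := @is_derive1_powR R (- z - 1)%R x x0.
- rewrite /F -[X in _ --> X](mulr0 (- z^-1)%R); apply: cvgMr.
  have : (u^-1 `^ z)%R @[u --> +oo%R] --> (0 : R)%R.
    apply: (@cvg_comp _ _ _ (fun u => u^-1)%R (fun u => u `^ z)%R _ (0%R)^'+); last exact: powR_cvg0.
    have cV : (u^-1)%R @[u --> +oo%R] --> (0 : R)%R.
      by apply/gtr0_cvgV0; [exact: nbhs_pinfty_gt|exact: cvg_id].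
    move=> A /cV hA; change (\forall u \near +oo%R, A (u^-1)%R).
    have hA' : \forall u \near +oo%R, ((0 < u^-1 :> R) -> A (u^-1))%R := hA.
    have h0 : \forall u \near +oo%R, (0 < u :> R)%R by exact: nbhs_pinfty_gt.
    by apply: filterS2 hA' h0 => u uA; rewrite -invr_gt0 => /uA.
  apply: cvg_trans; apply: near_eq_cvg; near=> u.
  have u0 : (0 <= u)%R by near: u; exact: nbhs_pinfty_ge.
  by rewrite powRN -powR_inv1// -powRrM mulN1r powRN.
- by move=> x x1; have [] := dF x (lt_trans ltr01 x1).
- apply: cvg_at_right_filter; apply: differentiable_continuous.
  by apply/derivable1_diffP; have [] := dF 1%R ltr01.
- move=> x; rewrite in_itv/= andbT => x1.
  by rewrite derive1E; apply: derive_val; exact: dF (lt_trans ltr01 x1).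
Unshelve. all: by end_near.
Qed.

Lemma integral_expRN t : (0 < t)%R ->
  \int[leb]_(u in `[1%R, +oo[) (t * expR (- (u * t)))%:E = (expR (- t))%:E.
Proof.
move=> t0.
pose F u : R := (- expR (- (u * t)))%R.
have dF (x : R) : is_derive x 1%R F (t * expR (- (x * t)))%R.
  have d1 : is_derive x 1%R (fun u : R => - (u * t))%R (- t)%R.
    rewrite [X in is_derive _ _ _ X](_ : _ = - (x *: 0 + t *: 1))%R; last first.
      by rewrite scaler0 add0r /GRing.scale/= mulr1.
    exact: is_deriveN.
  have H := is_deriveN (@is_derive1_comp _ expR (fun u : R => - (u * t))%R x _ _ (is_derive_expR _) d1).
  by rewrite (_ : t * _ = - (expR (- (x * t)) * - t))%R; [exact: H|ring].
rewrite (@ge0_continuous_FTC2y R _ F 1%R 0%R).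
- by rewrite /F mul1r -EFinN -EFinD sub0r opprK.
- by move=> x _; rewrite mulr_ge0 ?expR_ge0// ltW.
- apply: continuous_subspaceT => x; apply: cvgMr.
  apply: continuous_comp; last exact: continuous_expR.
  by apply: cvgN; apply: cvgMl; exact: cvg_id.
- rewrite /F -oppr0; apply: cvgN.
  apply: (@cvg_comp _ _ _ (fun u => u * t)%R (fun u => expR (- u)) _ +oo%R); last exact: cvgr_expR.
  exact: gt0_cvgMly.
- by move=> x x1; have [] := dF x.
- apply: cvg_at_right_filter; apply: differentiable_continuous.
  by apply/derivable1_diffP; have [] := dF 1%R.
- by move=> x _; rewrite derive1E; apply: derive_val; exact: dF.
Qed.


Lemma measurable_powR_expR a b :
  measurable_fun setT (fun x : measurableTypeR R * measurableTypeR R =>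
    (x.1 `^ a * x.2 `^ b * expR (- (x.2 * x.1)))%:E).
Proof.
apply/measurable_EFinP; apply: measurable_funM; first apply: measurable_funM.
- by apply: (@measurableT_comp _ _ _ _ _ _ (@powR R ^~ a)) => //; exact: measurable_powR.
- by apply: (@measurableT_comp _ _ _ _ _ _ (@powR R ^~ b)) => //; exact: measurable_powR.
- apply: measurableT_comp => //; apply: measurableT_comp => //.
  exact: measurable_funM.
Qed.

Lemma measurable_powR_expR1 a c : measurable_fun setT (fun t : measurableTypeR R =>
  (t `^ a * expR (- (c * t)))%:E).
Proof.
apply/measurable_EFinP; apply: measurable_funM; first exact: measurable_powR.
by apply: measurableT_comp => //; apply: measurableT_comp.
Qed.

(* Tonelli's theorem, after writing e^-t as the integral of t e^(-ut) over u > 1. *)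
Lemma eGammaE z : (0 < z)%R -> eGamma z = (z^-1)%:E * eGamma (z + 1).
Proof.
move=> z0.
transitivity (\int[leb]_(t in `]0%R, +oo[) \int[leb]_(u in `[1%R, +oo[)
    (t `^ (z + 1 - 1) * u `^ 0 * expR (- (u * t)))%:E).
  apply: eq_integral => t; rewrite inE/= in_itv/= andbT => t0.
  rewrite EFinM -integral_expRN// -ge0_integralZl_EFin ?powR_ge0//; last 2 first.
  - by move=> u _; rewrite lee_fin mulr_ge0 ?expR_ge0// ltW.
  - apply/measurable_EFinP; apply: measurable_funTS; apply: measurable_funM => //.
    by apply: measurableT_comp => //; apply: measurableT_comp => //; exact: mulrr_measurable.
  apply: eq_integral => u _; rewrite -EFinM powRr0 mulr1 mulrA; congr (_ * _)%:E.
  by rewrite -{2}(powRr1 (ltW t0)) -powRD ?(gt_eqF t0) ?implybT//; congr (_ `^ _)%R; ring.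
rewrite (@ge0_integral_swap R `]0%R, +oo[%classic `[1%R, +oo[%classic
  (fun x => (x.1 `^ (z + 1 - 1) * x.2 `^ 0 * expR (- (x.2 * x.1)))%:E))//; last 2 first.
- exact: measurable_powR_expR.
- by move=> x; rewrite lee_fin !mulr_ge0 ?powR_ge0 ?expR_ge0.
transitivity (\int[leb]_(u in `[1%R, +oo[) ((u `^ (- z - 1))%:E * eGamma (z + 1))).
  apply: eq_integral => u; rewrite inE/= in_itv/= andbT => u1.
  rewrite (_ : - z - 1 = - (z + 1))%R; last by ring.
  rewrite -eGamma_scale ?(lt_le_trans ltr01)//; apply: eq_integral => t _.
  by rewrite powRr0 mulr1.
rewrite ge0_integralZr//; last 3 first.
- by apply/measurable_EFinP; apply: measurable_funTS; exact: measurable_powR.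
- by move=> x _; rewrite lee_fin powR_ge0.
- exact: eGamma_ge0.
by rewrite integral_powRN.
Qed.

Lemma eGamma1 : eGamma 1 = 1.
Proof.
rewrite /eGamma.
transitivity (\int[leb]_(t in `]0%R, +oo[) (expR (- t))%:E).
  by apply: eq_integral => t _; rewrite subrr powRr0 mul1r.
rewrite integral_itv_obnd_cbnd; last first.
  by apply/measurable_EFinP; apply: measurable_funTS; apply: measurableT_comp.
pose F u : R := (- expR (- u))%R.
have dF (x : R) : is_derive x 1%R F (expR (- x))%R.
  have d1 : is_derive x 1%R (fun u : R => - u)%R (- 1)%R by exact: is_deriveN.
  have H := is_deriveN (@is_derive1_comp _ expR (fun u : R => - u)%R x _ _ (is_derive_expR _) d1).
  by rewrite (_ : expR (- x) = - (expR (- x) * - 1))%R; [exact: H|ring].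
rewrite (@ge0_continuous_FTC2y R _ F 0%R 0%R).
- by rewrite /F oppr0 expR0 -EFinN -EFinD sub0r opprK.
- by move=> x _; rewrite expR_ge0.
- apply: continuous_subspaceT => x; apply: continuous_comp; last exact: continuous_expR.
  by apply: cvgN; exact: cvg_id.
- by rewrite /F -oppr0; apply: cvgN; exact: cvgr_expR.
- by move=> x x1; have [] := dF x.
- apply: cvg_at_right_filter; apply: differentiable_continuous.
  by apply/derivable1_diffP; have [] := dF 0%R.
- by move=> x _; rewrite derive1E; apply: derive_val; exact: dF.
Qed.

Lemma eGammaS n : eGamma n.+1%:R = (n`!%:R)%:E.
Proof.
elim: n => [|n IHn]; first by rewrite eGamma1.
have := eGammaE (ltr0Sn R n); rewrite IHn natr1 => /(congr1 (fun x => (n.+1%:R)%:E * x)).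
rewrite muleA -!EFinM mulfV ?pnatr_eq0// mul1e => <-.
by rewrite factS natrM.
Qed.

(** The recurrence replaces [z] by [z + 1], where the power [t^z] is at most [1 + t^n] for any
    integer [n] above [z]. This majorant integrates to [0! + n!]. *)
Lemma eGamma_lty z : (0 < z)%R -> eGamma z < +oo.
Proof.
move=> z0; rewrite eGammaE//.
suff : eGamma (z + 1) < +oo.
  move: (eGamma_ge0 (z + 1)); case: (eGamma (z + 1)) => // r _ _.
  by rewrite -EFinM ltry.
pose n := (Num.truncn z).+1.
have zn : (z <= n%:R)%R by rewrite ltW// truncnS_gt.
apply: (@le_lt_trans _ _ (eGamma 1 + eGamma n.+1%:R)); last first.
  by rewrite eGamma1 eGammaS -EFinD ltry.
have me a : measurable_fun (`]0%R, +oo[%classic : set (measurableTypeR R)) (fun t : measurableTypeR R => (t `^ a * expR (- t))%:E).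
  by apply: measurable_funTS; have := measurable_powR_expR1 a 1; under eq_fun do rewrite mul1r.
have ge0 (a t : R) : 0 <= (t `^ a * expR (- t))%:E.
  by rewrite lee_fin mulr_ge0 ?powR_ge0 ?expR_ge0.
rewrite /eGamma -ge0_integralD//.
apply: ge0_le_integral => //.
- exact: emeasurable_funD.
move=> t; rewrite /= in_itv/= andbT => t0.
rewrite -EFinD lee_fin -mulrDl ler_wpM2r ?expR_ge0// subrr powRr0 addrK -natr1 addrK.
have [t1|t1] := leP t 1%R.
  rewrite (@le_trans _ _ 1%R)// ?lerDl ?powR_ge0//.
  by rewrite -(powRr0 t) ger_powR ?t0//= ltW.
by rewrite (le_trans (ler_powR (ltW t1) zn))// lerDr.
Qed.

(** If the integral vanished, the integrand would be zero almost everywhere; but it has no zero on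
    the half-line, whose measure is infinite. *)
Lemma eGamma_gt0 z : 0 < eGamma z.
Proof.
rewrite lt0e eGamma_ge0 andbT; apply/negP => /eqP G0.
have mf : measurable_fun (`]0%R, +oo[%classic : set (measurableTypeR R)) (fun t : measurableTypeR R => (t `^ (z - 1) * expR (- t))%:E).
  by apply: measurable_funTS; have := measurable_powR_expR1 (z - 1) 1; under eq_fun do rewrite mul1r.
have /(ae_eq_integral_abs leb (measurable_itv _) mf) : \int[leb]_(t in `]0%R, +oo[)
    `|(t `^ (z - 1) * expR (- t))%:E| = 0.
  rewrite -G0; apply: eq_integral => t _.
  by rewrite gee0_abs// lee_fin mulr_ge0 ?powR_ge0 ?expR_ge0.
move=> [N [mN N0 subN]].
have : leb (`]0%R, +oo[%classic : set R) <= leb N.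
  apply: le_measure; rewrite ?inE// => t /= t0; apply: subN => /= /(_ t0) => -[].
  move: t0; rewrite in_itv/= andbT => t0; apply/eqP.
  by rewrite mulf_neq0// ?gt_eqF ?powR_gt0 ?expR_gt0.
by rewrite lebesgue_measure_itv/= N0 ltry.
Qed.

Lemma eGammaK z : (0 < z)%R -> (Gamma z)%:E = eGamma z.
Proof.
move=> z0; rewrite /Gamma /Rintegral fineK// ge0_fin_numE; first exact: eGamma_lty.
exact: eGamma_ge0.
Qed.

Lemma Gamma_gt0 z : (0 < z)%R -> (0 < Gamma z)%R.
Proof. by move=> z0; rewrite -lte_fin eGammaK// eGamma_gt0. Qed.

Lemma GammaD1 z : (0 < z)%R -> (Gamma (z + 1) = z * Gamma z)%R.
Proof.
move=> z0; have z10 : (0 < z + 1)%R by rewrite addr_gt0.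
have := eGammaE z0; rewrite -(eGammaK z0) -(eGammaK z10) -EFinM => -[->].
by rewrite mulrA mulfV ?mul1r// gt_eqF.
Qed.

(** By [eGamma_scale], [eGamma (a + b)] times [(1+t)^-(a+b)] is the integral over [u] of
    [u^(a+b-1) e^(-(1+t)u)]. After exchanging the integrals, the one over [t] equals
    [u^-a eGamma a], which leaves the integrand of [eGamma b]. *)
Lemma eGammaM a b : (0 < a)%R -> (0 < b)%R ->
  eGamma (a + b) * \int[leb]_(t in `]0%R, +oo[) (t `^ (a - 1) * (1 + t) `^ (- (a + b)))%:E =
  eGamma a * eGamma b.
Proof.
move=> a0 b0.
have ab0 : (0 < a + b)%R by rewrite addr_gt0.
transitivity (\int[leb]_(t in `]0%R, +oo[) \int[leb]_(u in `]0%R, +oo[)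
   (u `^ (a + b - 1) * t `^ (a - 1) * expR (- u) * expR (- (t * u)))%:E).
  rewrite -ge0_integralZl//; last 3 first.
  - apply/measurable_EFinP; apply: measurable_funTS; apply: measurable_funM; first exact: measurable_powR.
    apply: (@measurableT_comp _ _ _ _ _ _ (@powR R ^~ (- (a + b))%R)); first exact: measurable_powR.
    exact: measurable_funD.
  - by move=> x _; rewrite lee_fin mulr_ge0 ?powR_ge0.
  - exact: eGamma_ge0.
  apply: eq_integral => t; rewrite inE/= in_itv/= andbT => t0.
  rewrite muleC (EFinM (t `^ (a - 1)) ((1 + t) `^ (- (a + b)))) -muleA.
  rewrite -(@eGamma_scale (a + b)) ?addr_gt0//.
  rewrite -ge0_integralZl_EFin ?powR_ge0//; last 2 first.
  - by move=> u _; rewrite lee_fin mulr_ge0 ?powR_ge0 ?expR_ge0.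
  - by apply: measurable_funTS; exact: measurable_powR_expR1.
  apply: eq_integral => u _; rewrite -EFinM; congr EFin.
  by rewrite mulrDl mul1r opprD expRD; ring.
rewrite (@ge0_integral_swap R `]0%R, +oo[%classic `]0%R, +oo[%classic
  (fun x => (x.2 `^ (a + b - 1) * x.1 `^ (a - 1) * expR (- x.2) * expR (- (x.1 * x.2)))%:E))//; last 2 first.
- rewrite [X in measurable_fun _ X](_ : _ = fun x : measurableTypeR R * measurableTypeR R =>
     (x.1 `^ (a - 1) * x.2 `^ (a + b - 1) * expR (- (x.2 * x.1)))%:E * (expR (- x.2))%:E).
    apply: emeasurable_funM; first exact: measurable_powR_expR.
    by apply/measurable_EFinP; apply: measurableT_comp => //; exact: measurableT_comp.
  by apply/funext => x; rewrite -EFinM (mulrC x.1 x.2); congr EFin; ring.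
- by move=> x; rewrite lee_fin !mulr_ge0 ?powR_ge0 ?expR_ge0.
rewrite muleC /(eGamma b) -ge0_integralZr//; last 3 first.
- by apply: measurable_funTS; have := measurable_powR_expR1 (b - 1) 1; under eq_fun do rewrite mul1r.
- by move=> x _; rewrite lee_fin mulr_ge0 ?powR_ge0 ?expR_ge0.
- exact: eGamma_ge0.
apply: eq_integral => u; rewrite inE/= in_itv/= andbT => u0.
transitivity ((u `^ (a + b - 1) * expR (- u))%:E * ((u `^ (- a))%:E * eGamma a)).
  rewrite -eGamma_scale// -ge0_integralZl_EFin ?mulr_ge0 ?powR_ge0 ?expR_ge0//; last 2 first.
  - by move=> t _; rewrite lee_fin mulr_ge0 ?powR_ge0 ?expR_ge0.
  - by apply: measurable_funTS; exact: measurable_powR_expR1.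
  by apply: eq_integral => t _; rewrite -EFinM (mulrC t u); congr EFin; ring.
rewrite muleA -EFinM; congr (_%:E * _).
rewrite mulrAC; congr (_ * _)%R.
by rewrite -powRD ?(gt_eqF u0) ?implybT//; congr (_ `^ _)%R; ring.
Qed.

Lemma integral_beta a b : (0 < a)%R -> (0 < b)%R ->
  \int[leb]_(t in `]0%R, +oo[) (t `^ (a - 1) * (1 + t) `^ (- (a + b)))%:E =
  (Gamma a * Gamma b / Gamma (a + b))%:E.
Proof.
move=> a0 b0; have ab0 : (0 < a + b)%R by rewrite addr_gt0.
have := eGammaM a0 b0; rewrite -(eGammaK a0) -(eGammaK b0) -(eGammaK ab0) -EFinM.
set I := integral _ _ _ => /(congr1 (fun x => ((Gamma (a + b))^-1)%:E * x)).
rewrite muleA -!EFinM mulVf ?mul1e ?(gt_eqF (Gamma_gt0 ab0))// => ->.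
by rewrite mulrC.
Qed.

End gamma_function.

(** * Univariate orthogonality *)

(* Otherwise unification unfolds Gamma down to the construction of the integral. *)
Local Opaque Gamma.

Section beta_functional.
Context {R : realType}.
Local Notation leb := (@lebesgue_measure R).
Local Notation pos := (`]0%R, +oo[%classic : set (measurableTypeR R)).
Implicit Types (a b s p q : R) (f G : {poly R}).

(** The second exponent is stored with its sign changed, so the weight of [M_ n p q] has [a = q] and
    [s = p + q]. *)
Definition beta_weight a s (t : measurableTypeR R) : R := t `^ a * (1 + t) `^ (- s).

Lemma measurable_beta_weight a s : measurable_fun setT (beta_weight a s).
Proof.
apply: measurable_funM; first exact: measurable_powR.
apply: (@measurableT_comp _ _ _ _ _ _ (@powR R ^~ (- s))); first exact: measurable_powR.
exact: measurable_funD.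
Qed.

Lemma beta_weight_ge0 a s t : 0 <= beta_weight a s t.
Proof. by rewrite mulr_ge0 ?powR_ge0. Qed.

Lemma integral_beta_weight a s : 0 < a + 1 -> a + 1 < s ->
  (\int[leb]_(t in pos) (beta_weight a s t)%:E =
   (Gamma (a + 1) * Gamma (s - (a + 1)) / Gamma s)%:E)%E.
Proof.
move=> a1 as1; have sa0 : 0 < s - (a + 1) by rewrite subr_gt0.
by have := integral_beta a1 sa0; rewrite addrK addrCA subrr addr0.
Qed.

Lemma integrable_beta_weight a s : 0 < a + 1 -> a + 1 < s ->
  leb.-integrable pos (EFin \o beta_weight a s).
Proof.
move=> a1 as1; apply/integrableP; split.
  by apply/measurable_EFinP; apply: measurable_funTS; exact: measurable_beta_weight.
rewrite [X in (X < _)%E](_ : _ = \int[leb]_(t in pos) (beta_weight a s t)%:E)%E.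
  by rewrite integral_beta_weight// ltry.
by apply: eq_integral => t _ /=; rewrite ger0_norm ?beta_weight_ge0.
Qed.

Lemma beta_weightXn a s (j : nat) (t : R) : 0 < t ->
  beta_weight a s t * t ^+ j = beta_weight (a + j%:R) s t.
Proof.
move=> t0; rewrite /beta_weight mulrAC powRD ?(gt_eqF t0) ?implybT//.
by rewrite powR_mulrn ?ltW.
Qed.

Definition poly_weight a s G (t : measurableTypeR R) : R := beta_weight a s t * G.[t].

(** The integral of [t^i] against [beta_weight a s], in the closed form that [integral_beta_weight]
    gives when [0 < a + i + 1 < s]. *)
Definition beta_moment a s (i : nat) : R :=
  Gamma (a + i%:R + 1) * Gamma (s - (a + i%:R + 1)) / Gamma s.

Lemma poly_weightE a s G n (t : R) : (size G <= n)%N -> 0 < t ->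
  poly_weight a s G t = \sum_(i < n) G`_i * beta_weight (a + i%:R) s t.
Proof.
move=> Gn t0; rewrite /poly_weight (horner_coef_wide _ Gn) mulr_sumr.
by apply: eq_bigr => i _; rewrite mulrCA beta_weightXn.
Qed.

Lemma integrable_poly_weight_sum a s G n : 0 < a + 1 -> a + n%:R < s ->
  leb.-integrable pos (fun t => \sum_(i < n) (G`_i * beta_weight (a + i%:R) s t)%:E)%E.
Proof.
move=> a1 as1; apply: integrable_sum => // i _.
rewrite (_ : (fun t => _) = (fun t => (G`_i)%:E * (EFin \o beta_weight (a + i%:R) s) t)%E); last first.
  by apply/funext => t /=; rewrite EFinM.
apply: integrableZl => //; apply: integrable_beta_weight.
  by rewrite addrAC ltr_pwDl.
by rewrite -addrA natr1 (le_lt_trans _ as1)// lerD2l ler_nat.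
Qed.

Lemma integrable_poly_weight_wide a s G n : 0 < a + 1 -> a + n%:R < s ->
  (size G <= n)%N -> leb.-integrable pos (EFin \o poly_weight a s G).
Proof.
move=> a1 as1 Gn; have := integrable_poly_weight_sum G a1 as1.
apply: eq_integrable => // t; rewrite inE/= in_itv/= andbT => t0.
by rewrite sumEFin; congr EFin; exact/esym/poly_weightE.
Qed.

Definition beta_int a s G : R := Rintegral leb pos (poly_weight a s G).

(** Reduces integrals of polynomials to a finite sum of moments. The condition [a + n < s] makes the
    highest possible power, [t^(n-1)], integrable. *)
Lemma beta_intE a s G n : 0 < a + 1 -> a + n%:R < s -> (size G <= n)%N ->
  beta_int a s G = \sum_(i < n) G`_i * beta_moment a s i.
Proof.
move=> a1 as1 Gn; apply: EFin_inj.
rewrite /beta_int /Rintegral fineK; last first.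
  by apply: integrable_fin_num => //; exact: (integrable_poly_weight_wide a1 as1 Gn).
transitivity (\int[leb]_(t in pos) \sum_(i < n) (G`_i * beta_weight (a + i%:R) s t)%:E)%E.
  apply: eq_integral => t; rewrite inE/= in_itv/= andbT => t0.
  by rewrite sumEFin; congr EFin; exact: poly_weightE.
have ai (i : 'I_n) : 0 < a + i%:R + 1 by rewrite addrAC ltr_pwDl.
have ais (i : 'I_n) : a + i%:R + 1 < s.
  by rewrite -addrA natr1 (le_lt_trans _ as1)// lerD2l ler_nat.
rewrite integral_sum//; last first.
  move=> i; rewrite (_ : (fun t => _) = (fun t => (G`_i)%:E * (EFin \o beta_weight (a + i%:R) s) t)%E); last first.
    by apply/funext => t /=; rewrite EFinM.
  by apply: integrableZl => //; exact: integrable_beta_weight.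
rewrite -sumEFin; apply: eq_bigr => i _.
under eq_integral do rewrite EFinM.
rewrite integralZl//; last exact: integrable_beta_weight.
by rewrite integral_beta_weight// -EFinM.
Qed.

(** The factor [t (1 + t)] is absorbed by raising both exponents of the weight by one; this brings
    the two sides of the integration by parts to the same weight. *)
Lemma beta_intXX1 a s G : beta_int (a - 1) (s + 1) ('X * (1 + 'X) * G) = beta_int a s G.
Proof.
rewrite /beta_int; apply: eq_Rintegral => t; rewrite inE/= in_itv/= andbT => t0.
rewrite /poly_weight /beta_weight.
have -> : ('X * (1 + 'X) * G).[t] = t * (1 + t) * G.[t] by rewrite !hornerE.
rewrite mulrA; congr (_ * _).
have t10 : 0 < 1 + t by rewrite addr_gt0.
rewrite mulrACA; congr (_ * _).
  by rewrite -[X in _ * X](powRr1 (ltW t0)) -powRD ?(gt_eqF t0) ?implybT// subrK.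
rewrite -[X in _ * X](powRr1 (ltW t10)) -powRD ?(gt_eqF t10) ?implybT//.
by rewrite opprD subrK.
Qed.

(** This says that the derivative of [t^(a+i) (1+t)^b] has integral zero. It is obtained from
    [Gamma (z + 1) = z * Gamma z] alone, so no limit at 0 or at infinity is taken. *)
Lemma beta_moment_rec a b (i : nat) : 0 < a -> a + b + i%:R < 0 ->
  (a + i%:R) * beta_moment (a - 1) (1 - b) i +
  (a + b + i%:R) * beta_moment (a - 1) (1 - b) i.+1 = 0.
Proof.
move=> a0 ab.
have ai0 : 0 < a + i%:R by rewrite ltr_pwDl.
have ab0 : 0 < - (a + b + i%:R) by rewrite oppr_gt0.
have -> : beta_moment (a - 1) (1 - b) i =
   Gamma (a + i%:R) * Gamma (- (a + b + i%:R) + 1) / Gamma (1 - b).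
  rewrite /beta_moment (_ : a - 1 + i%:R + 1 = a + i%:R); last by ring.
  by rewrite (_ : 1 - b - (a + i%:R) = - (a + b + i%:R) + 1); last by ring.
have -> : beta_moment (a - 1) (1 - b) i.+1 =
   Gamma (a + i%:R + 1) * Gamma (- (a + b + i%:R)) / Gamma (1 - b).
  rewrite /beta_moment (_ : a - 1 + i.+1%:R + 1 = a + i%:R + 1); last by rewrite -natr1; ring.
  by rewrite (_ : 1 - b - (a + i%:R + 1) = - (a + b + i%:R)); last by ring.
rewrite (GammaD1 ai0) (GammaD1 ab0).
move: (Gamma (a + i%:R)) (Gamma (- (a + b + i%:R))) (Gamma (1 - b)) => x y z.
ring.
Qed.

(* The polynomial T G such that
   (t^a (1+t)^b G)' = t^(a-1) (1+t)^(b-1) T G. *)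
Definition weight_deriv a b G : {poly R} :=
  (a *: (1 + 'X) + b *: 'X) * G + 'X * (1 + 'X) * G^`().

Lemma coef_weight_deriv a b G i : (weight_deriv a b G)`_i =
  (a + i%:R) * G`_i + (if i is j.+1 then (a + b + j%:R) * G`_j else 0).
Proof.
have -> : weight_deriv a b G = a *: G + (a + b) *: ('X * G) + ('X * G^`() + 'X * ('X * G^`())).
  by rewrite /weight_deriv scalerDr mulrDl scalerDl -!scalerAl mulrDl mulrDr; rewrite -!mul_polyC; ring.
rewrite !coefD !coefZ !coefXM coef_deriv.
case: i => [|i] /=; first by rewrite addr0 mulr0 !addr0.
have -> : (if i == 0%N then 0 else G^`()`_i.-1) = i%:R * G`_i.
  by case: i => [|i]; rewrite ?mul0r//= coef_deriv mulr_natl.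
rewrite -[G`_i.+1 *+ i.+1]mulr_natl; move: (i.+1%:R : R) (i%:R : R) => x y; ring.
Qed.

Lemma size_weight_deriv a b G : (size (weight_deriv a b G) <= (size G).+1)%N.
Proof.
apply/leq_sizeP => i Gi; rewrite coef_weight_deriv.
rewrite nth_default ?mulr0 ?add0r; last exact: ltnW.
by case: i Gi => // i Gi; rewrite nth_default ?mulr0.
Qed.

(** Each coefficient of [G] contributes two consecutive moments, which cancel by
    [beta_moment_rec]. *)
Lemma beta_int_deriv a b G : 0 < a -> a + b + (size G)%:R < 1 ->
  beta_int (a - 1) (1 - b) (weight_deriv a b G) = 0.
Proof.
move=> a0 ab; rewrite (@beta_intE _ _ _ (size G).+1) ?subrK//; last 2 first.
- by rewrite -natr1; lra.
- exact: size_weight_deriv.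
under eq_bigr do rewrite coef_weight_deriv mulrDl.
(* Aligns the two sums: the first loses its last term, where the coefficient of [G] is past the end,
   and the second its first term, which is 0 by definition. *)
rewrite big_split/= big_ord_recr/= nth_default// mulr0 mul0r addr0.
rewrite [X in _ + X]big_ord_recl/= mul0r add0r.
rewrite -big_split big1//= => i _; rewrite add0n -[bump 0 i]/(i.+1).
have : a + b + i%:R < 0.
  have : (i.+1%:R <= (size G)%:R :> R) by rewrite ler_nat.
  by rewrite -natr1; lra.
move=> /(beta_moment_rec a0) /(congr1 ( *%R G`_i)); rewrite mulr0 => E; rewrite -[RHS]E {E}.
move: (beta_moment _ _ i) (beta_moment _ _ i.+1) (G`_i) => x y z. ring.
Qed.

End beta_functional.

(** * Rodrigues' formula, repeated integration by parts, and the norms [h_] *)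

Section rodrigues_polynomials.
Context {R : realType}.
Implicit Types (a b s p q : R) (f G : {poly R}).

(** The polynomial factor of the [k]-th derivative of [x^a (1+x)^b], once [x^(a-k) (1+x)^(b-k)] is
    taken out; see [derive1n_powR]. *)
Fixpoint rodrigues_rec a b k : {poly R} :=
  if k is j.+1 then weight_deriv (a - j%:R) (b - j%:R) (rodrigues_rec a b j) else 1.

Lemma size_rodrigues_rec a b k : (size (rodrigues_rec a b k) <= k.+1)%N.
Proof.
elim: k => [|k IH] /=; first by rewrite size_poly1.
exact: leq_trans (size_weight_deriv _ _ _) _.
Qed.

Lemma coef_rodrigues_rec a b k :
  (rodrigues_rec a b k)`_k = \prod_(i < k) (a + b - i%:R).
Proof.
elim: k => [|k IH] /=; first by rewrite coef1 big_ord0.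
rewrite coef_weight_deriv nth_default ?size_rodrigues_rec// mulr0 add0r IH.
by rewrite big_ord_recr/= mulrC; congr (_ * _); ring.
Qed.

Lemma derive1n_powR a b k x : 0 < x ->
  derive1n k (fun y : R => y `^ a * (1 + y) `^ b) x =
  x `^ (a - k%:R) * (1 + x) `^ (b - k%:R) * (rodrigues_rec a b k).[x].
Proof.
elim: k x => [|k IH] x x0 /=; first by rewrite !subr0 hornerC mulr1.
have x10 : 0 < 1 + x by rewrite addr_gt0.
set Q := rodrigues_rec a b k in IH *.
(* The induction hypothesis holds only at positive points, which suffices because a derivative
   depends only on a neighbourhood of [x]. *)
rewrite derive1E (@near_eq_derive _ _ _ _
  (fun y : R => y `^ (a - k%:R) * (1 + y) `^ (b - k%:R) * Q.[y])) ?oner_eq0//; last first.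
  by near=> z; apply: IH; near: z; exact: lt_nbhsr.
rewrite -natr1 !opprD !addrA.
move: (a - k%:R) (b - k%:R) => a' b' {IH}.
have d1 : is_derive x 1 (fun y : R => y `^ a') (a' * x `^ (a' - 1)) by exact: is_derive1_powR.
have d2 : is_derive x 1 (fun y : R => (1 + y) `^ b') (b' * (1 + x) `^ (b' - 1)).
  have d3 : is_derive (1 + x) 1 (fun y : R => y `^ b') (b' * (1 + x) `^ (b' - 1)).
    exact: is_derive1_powR.
  have d4 : is_derive x 1 (fun y : R => 1 + y) 1.
    by rewrite -[X in is_derive _ _ _ X]add0r; apply: is_deriveD.
  by have := is_derive1_comp d3 d4; rewrite mulr1.
have d5 : is_derive x 1 (horner Q) Q^`().[x] by exact: is_derive_poly.
have E := @derive_val _ _ _ _ _ _ _ (is_deriveM (is_deriveM d1 d2) d5).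
rewrite (_ : (fun y : R => _) = (fun y => y `^ a') * (fun y => (1 + y) `^ b') * horner Q)//.
rewrite E /GRing.scale/= mulrfctE /weight_deriv !(hornerD, hornerZ, hornerM, hornerX, hornerC).
have powRB (u c : R) : 0 < u -> u `^ c = u * u `^ (c - 1).
  by move=> u0; rewrite -[X in X * _]powRr1 ?ltW// -powRD ?(gt_eqF u0) ?implybT// addrC subrK.
rewrite (powRB x a' x0) (powRB (1 + x) b' x10).
move: (x `^ _) ((1 + x) `^ _) => y z; ring.
Unshelve. all: by end_near.
Qed.

Lemma M_rodrigues n p q :
  M_ n p q = (-1) ^+ n *: rodrigues_rec (n%:R + q) (n%:R - p - q) n.
Proof.
apply/esym/M_unique => x x0; rewrite hornerZ /rodrigues derive1n_powR//.
have x10 : 0 < 1 + x by rewrite addr_gt0.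
rewrite (_ : n%:R + q - n%:R = q); last by ring.
rewrite (_ : n%:R - p - q - n%:R = - (p + q)); last by ring.
rewrite powRN; field.
by rewrite !gt_eqF ?powR_gt0.
Qed.

Lemma size_M n p q : (size (M_ n p q) <= n.+1)%N.
Proof. by rewrite M_rodrigues (leq_trans (size_scale_leq _ _))// size_rodrigues_rec. Qed.

(** The factors of [coef_rodrigues_rec] are [2n - p - i]; the sign [(-1)^n] turns each into
    [p - 2n + i]. *)
Lemma coef_M n p q : (M_ n p q)`_n = pochhammer (p - 2 * n%:R) n.
Proof.
rewrite M_rodrigues coefZ coef_rodrigues_rec.
rewrite -[X in (-1) ^+ X](card_ord n) -prodrN; apply: eq_bigr => i _; ring.
Qed.

Lemma beta_intB a s f G n : 0 < a + 1 -> a + n%:R < s ->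
  (size f <= n)%N -> (size G <= n)%N ->
  beta_int a s (f - G) = beta_int a s f - beta_int a s G.
Proof.
move=> a1 as1 fn Gn; rewrite !(@beta_intE _ _ _ _ n)//; last first.
  by rewrite (leq_trans (size_polyD _ _))// size_polyN geq_max fn.
by rewrite -sumrB; apply: eq_bigr => i _; rewrite coefB mulrBl.
Qed.

(** The product rule for [weight_deriv] applied to [f * Q]: the total derivative integrates to zero
    by [beta_int_deriv], and the factor [X (1 + X)] in front of [f' Q] goes into the weight by
    [beta_intXX1]. *)
Lemma beta_int_by_parts a b k f :
  k%:R < a -> a + b - k%:R + (size f)%:R < 1 ->
  beta_int (a - k.+1%:R) (k.+1%:R - b) (f * rodrigues_rec a b k.+1) =
  - beta_int (a - k%:R) (k%:R - b) (f^`() * rodrigues_rec a b k).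
Proof.
move=> ka fk /=; have := size_rodrigues_rec a b k.
set Q := rodrigues_rec a b k => Qk.
have fQ : (size (f * Q)%R <= size f + k)%N.
  by have := size_polyMleq f Q; move: Qk; lia.
have szN : (size f + k)%:R = (size f)%:R + k%:R :> R by rewrite natrD.
have -> : f * weight_deriv (a - k%:R) (b - k%:R) Q =
   weight_deriv (a - k%:R) (b - k%:R) (f * Q) - 'X * (1 + 'X) * (f^`() * Q).
  by rewrite /weight_deriv derivM; ring.
have sT := size_weight_deriv (a - k%:R) (b - k%:R) (f * Q).
(* Writing this term as a difference bounds its size by those of the other two, without discussing
   the size of the derivative of [f]. *)
have eX : 'X * (1 + 'X) * (f^`() * Q) = weight_deriv (a - k%:R) (b - k%:R) (f * Q) -
   f * weight_deriv (a - k%:R) (b - k%:R) Q.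
  by rewrite /weight_deriv derivM; ring.
have sP : (size (f * weight_deriv (a - k%:R) (b - k%:R) Q)%R <= (size f + k).+1)%N.
  have := size_polyMleq f (weight_deriv (a - k%:R) (b - k%:R) Q).
  by have := size_weight_deriv (a - k%:R) (b - k%:R) Q; move: Qk; lia.
have -> : a - k.+1%:R = a - k%:R - 1 by rewrite -natr1; ring.
have -> : k.+1%:R - b = 1 - (b - k%:R) by rewrite -natr1; ring.
rewrite (@beta_intB _ _ _ _ (size f + k).+1)//; last 4 first.
- by rewrite subrK subr_gt0.
- by rewrite -natr1 szN; lra.
- by rewrite (leq_trans sT).
- by rewrite eX (leq_trans (size_polyD _ _))// size_polyN geq_max sP (leq_trans sT).
rewrite beta_int_deriv ?subr_gt0//; last first.
  have : (size (f * Q))%:R <= (size f)%:R + k%:R :> R by rewrite -natrD ler_nat.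
  by lra.
rewrite sub0r; congr (- _).
rewrite -[RHS]beta_intXX1 (_ : k%:R - b + 1 = 1 - (b - k%:R))//; ring.
Qed.

(** Weight times [rodrigues_rec] is the [k]-th derivative of [t^(n+q) (1+t)^(n-p-q)]. With [n]
    fixed, induction on [k] moves one derivative at a time onto [f], whose degree bound drops along
    with [k]. *)
Lemma beta_int_rodrigues p q n k f : (k <= n)%N -> (size f <= k.+1)%N ->
  -1 < q -> 2 * n%:R + 1 < p ->
  beta_int (n%:R + q - k%:R) (k%:R - (n%:R - p - q)) (f * rodrigues_rec (n%:R + q) (n%:R - p - q) k) =
  (-1) ^+ k * beta_int (n%:R + q) (p + q - n%:R) f^`(k).
Proof.
move=> + + q1 np; elim: k f => [|k IH] f kn fk.
  by rewrite mulr1 mul1r !subr0 sub0r derivn0 (_ : - (n%:R - p - q) = p + q - n%:R); last by ring.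
have kn' : k.+1%:R <= n%:R :> R by rewrite ler_nat.
have fk' : (size f)%:R <= k.+2%:R :> R by rewrite ler_nat.
move: kn' fk'; rewrite -!natr1 => kn' fk'.
rewrite natr1 beta_int_by_parts; last 2 first.
- lra.
- lra.
rewrite IH; last 2 first.
- exact: ltnW.
- by apply/leq_sizeP => i ki; rewrite coef_deriv nth_default ?mul0rn// (leq_trans fk).
by rewrite exprS mulN1r mulNr -derivSn.
Qed.

Lemma derivn_size n f : (size f <= n.+1)%N -> f^`(n) = (n`!%:R * f`_n)%:P.
Proof.
move=> fn; apply/polyP => i; rewrite coef_derivn coefC.
case: i => [|i]; first by rewrite addn0 ffactnn mulr_natl.
by rewrite nth_default ?mul0rn//= (leq_trans fn)// addnS ltnS leq_addr.
Qed.

(** With [k = n] in [beta_int_rodrigues], the derivative of [f] is the constant [n!] times its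
    coefficient of degree [n], and a single Beta integral remains. The sign of Rodrigues' formula,
    moved into [g], cancels the one from the integrations by parts. *)
Lemma beta_int_M p q n f : (size f <= n.+1)%N -> -1 < q -> 2 * n%:R + 1 < p ->
  beta_int q (p + q) (f * M_ n p q) =
  n`!%:R * f`_n * (Gamma (n%:R + q + 1) * Gamma (p - 2 * n%:R - 1) / Gamma (p + q - n%:R)).
Proof.
move=> fn q1 np; pose g := (-1) ^+ n *: f.
have gn : (size g <= n.+1)%N by rewrite (leq_trans (size_scale_leq _ _)).
have -> : f * M_ n p q = g * rodrigues_rec (n%:R + q) (n%:R - p - q) n.
  by rewrite M_rodrigues -scalerAr -scalerAl.
have := beta_int_rodrigues (leqnn n) gn q1 np.
rewrite (_ : n%:R + q - n%:R = q); last by ring.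
rewrite (_ : n%:R - (n%:R - p - q) = p + q); last by ring.
move=> ->; rewrite (derivn_size gn) (@beta_intE _ _ _ _ 1).
- rewrite big_ord1 coefC eqxx coefZ /beta_moment addr0.
  rewrite (_ : p + q - n%:R - (n%:R + q + 1) = p - 2 * n%:R - 1); last by ring.
  move: (Gamma _ * _ / _) => B; have := sqrr_sign R n.
  move: ((-1) ^+ n) (n`!%:R : R) (f`_n) => e c d e2.
  by rewrite -[RHS]mul1r -e2; ring.
- by have := ler0n R n; lra.
- lra.
- exact: size_polyC_leq1.
Qed.

Lemma Gamma_pochhammer (z : R) n : 0 < z -> Gamma (z + n%:R) = pochhammer z n * Gamma z.
Proof.
move=> z0; elim: n => [|n IH]; first by rewrite addr0 /pochhammer big_ord0 mul1r.
have zn : 0 < z + n%:R by rewrite ltr_pwDl.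
rewrite -natr1 addrA (GammaD1 zn) IH /pochhammer big_ord_recr/= mulrA.
by congr (_ * _); rewrite mulrC.
Qed.

Lemma c_gt0 p q : 1 < p -> -1 < q -> 0 < c_ p q.
Proof.
by move=> p1 q1; rewrite /c_ divr_gt0 ?mulr_gt0 ?Gamma_gt0//; lra.
Qed.

(** The right-hand side is what [beta_int_M] yields for [f = M_ n p q], whose coefficient of degree
    [n] is given by [coef_M]. So [h_] is the squared norm for the weight normalized by [c_]. *)
Lemma h_div_c n p q : -1 < q -> 2 * n%:R + 1 < p ->
  h_ n p q / c_ p q = n`!%:R * pochhammer (p - 2 * n%:R) n *
    (Gamma (n%:R + q + 1) * Gamma (p - 2 * n%:R - 1) / Gamma (p + q - n%:R)).
Proof.
move=> q1 np; have n0 := ler0n R n.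
rewrite /h_ /c_ /rfact.
rewrite (_ : p - n%:R - 1 + 1 = p - 2 * n%:R + n%:R); last by ring.
rewrite (_ : p + q - 1 + 1 = p + q); last by ring.
rewrite (_ : p - 2 + 1 = p - 1); last by ring.
rewrite (_ : p + q - n%:R - 1 + 1 = p + q - n%:R); last by ring.
rewrite (_ : n%:R + q + 1 = q + 1 + n%:R); last by ring.
rewrite !Gamma_pochhammer; [|lra..].
have -> : Gamma (p - 2 * n%:R) = (p - 2 * n%:R - 1) * Gamma (p - 2 * n%:R - 1).
  by rewrite -GammaD1 ?subrK//; lra.
have : 0 < Gamma (p + q) by apply: Gamma_gt0; lra.
have : 0 < Gamma (p - 1) by apply: Gamma_gt0; lra.
have : 0 < Gamma (q + 1) by apply: Gamma_gt0; lra.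
have : 0 < Gamma (p + q - n%:R) by apply: Gamma_gt0; lra.
have : 0 < p - 2 * n%:R - 1 by lra.
move: (Gamma (p + q)) (Gamma (p - 1)) (Gamma (q + 1)) (Gamma (p + q - n%:R)).
move: (Gamma (p - 2 * n%:R - 1)) => g a b c d.
move: (pochhammer _ _) (pochhammer _ _) (p - _ - 1) => P1 P2 x.
move=> x0 d0 c0 b0 a0; field.
by rewrite !gt_eqF.
Qed.

Lemma h_gt0 n p q : -1 < q -> 2 * n%:R + 1 < p -> 0 < h_ n p q.
Proof.
move=> q1 np; have n0 := ler0n R n.
have p1 : 1 < p by lra.
rewrite -(@pmulr_lgt0 _ (c_ p q)^-1) ?invr_gt0 ?c_gt0// h_div_c//.
by rewrite !mulr_gt0 ?invr_gt0 ?Gamma_gt0 ?ltr0n ?fact_gt0//;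
  [apply: prodr_gt0 => i _; rewrite ltr_wpDr//|..]; lra.
Qed.

(** By symmetry let [n <= n'] and apply [beta_int_M] with [M_ n p q] as the test polynomial: its
    coefficient of degree [n'] is zero unless the degrees agree. *)
Lemma beta_int_MM n n' p q : -1 < q -> 2 * (maxn n n')%:R + 1 < p ->
  beta_int q (p + q) (M_ n p q * M_ n' p q) = (n == n')%:R * (h_ n p q / c_ p q).
Proof.
move=> q1.
wlog nn' : n n' / (n <= n')%N.
  move=> W; have /orP[|n'n] := leq_total n n'; first exact: W.
  rewrite maxnC => /(W _ _ n'n); rewrite mulrC => ->.
  by case: (eqVneq n' n) => [->//|_]; rewrite !mul0r.
rewrite (maxn_idPr nn') => np; rewrite beta_int_M//; last first.
  by rewrite (leq_trans (size_M _ _ _)).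
case: (eqVneq n n') np => [<-|nE] np; first by rewrite coef_M mul1r h_div_c.
have nn : (size (M_ n p q) <= n')%N by rewrite (leq_trans (size_M _ _ _))// ltn_neqAle nE.
by rewrite (nth_default _ nn) mulr0 !mul0r.
Qed.

End rodrigues_polynomials.

(** * Dilations of Lebesgue measure and integration over the cone *)

Section lebesgue_tuple_theory.
Context {R : realType}.
Local Notation RT := (measurableTypeR R).
Local Notation leb := (@lebesgue_measure R).
Local Notation lebt d := (@lebesgue_tuple R d).
Local Open Scope ereal_scope.

(** The recursion defining [lebesgue_tuple] yields a bare measure. This equality lets it be
    rewritten into a bundled sigma-finite one, as Fubini's and Tonelli's theorems require. *)
Lemma sigma_finite_measureP (dd : measure_display) (T : measurableType dd)
    (m : {measure set T -> \bar R}) : sigma_finite setT m ->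
  exists m' : {sigma_finite_measure set T -> \bar R}, m = m'.
Proof.
move=> sm.
case: m sm => m [c1 c2] sm.
pose M := Measure.Pack (Measure.Class c2).
pose m' : {sigma_finite_measure set T -> \bar R} :=
  HB.pack (Measure.sort M) (@Measure_isSigmaFinite.Build _ _ _ (Measure.sort M) sm).
by exists m'.

Qed.


(** Cubes of finite measure exhausting the space, for sigma-finiteness. *)
Definition tuple_box d k : set (d.-tuple RT) :=
  [set x | forall i, (`|tnth x i| <= k%:R)%R].

Arguments tuple_box : clear implicits.

Lemma measurable_tuple_box d k : measurable (tuple_box d k).
Proof.
have -> : tuple_box d k = \bigcap_(i in [set: 'I_d]) ((fun x : d.-tuple RT => tnth x i) @^-1` `[(- k%:R)%R, k%:R]%classic).
  apply/seteqP; split => [x xk i _|x xk i] /=.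
    by rewrite in_itv/= -ler_norml.
  by have := xk i Logic.I; rewrite /= in_itv/= -ler_norml.
apply: fin_bigcap_measurable; first exact: finite_finset.
by move=> i _; rewrite -[X in measurable X]setTI; exact: measurable_tnth.
Qed.

Lemma lebesgue_tupleS d (A : set (d.+1.-tuple RT)) :
  lebt d.+1 A = (lebt d \x leb) (@snoc RT d @^-1` A).
Proof. by []. Qed.

Lemma tnth_snoc_widen d (x : d.-tuple RT) (t : RT) (i : 'I_d) :
  tnth (snoc (x, t)) (widen_ord (leqnSn d) i) = tnth x i.
Proof. by rewrite !(tnth_nth t)/= nth_rcons size_tuple ltn_ord. Qed.

Lemma tnth_snoc_max d (x : d.-tuple RT) (t : RT) : tnth (snoc (x, t)) ord_max = t.
Proof. by rewrite (tnth_nth t)/= nth_rcons size_tuple ltnn eqxx. Qed.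

Lemma lebesgue_tuple_box d k : lebt d (tuple_box d k) < +oo.
Proof.
elim: d => [|d IH]; first by rewrite /= diracE; case: (_ \in _); rewrite ltry.
rewrite lebesgue_tupleS.
have -> : @snoc RT d @^-1` (tuple_box d.+1 k) = tuple_box d k `*` `[(- k%:R)%R, k%:R]%classic.
  apply/seteqP; split => -[x t] /=.
    move=> xk; split => [i|].
      by have := xk (widen_ord (leqnSn d) i); rewrite tnth_snoc_widen.
    by have := xk ord_max; rewrite tnth_snoc_max in_itv/= -ler_norml.
  rewrite in_itv/= -ler_norml => -[xk tk] i.
  have [id|di] := ltnP i d.
    rewrite (_ : i = widen_ord (leqnSn d) (Ordinal id)) ?tnth_snoc_widen//.
    exact: val_inj.
  rewrite (_ : i = ord_max) ?tnth_snoc_max//; apply: val_inj => /=.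
  by apply/eqP; rewrite eqn_leq di -ltnS ltn_ord.
rewrite product_measure1E//; last exact: measurable_tuple_box.
apply: lte_mul_pinfty => //; first by rewrite ge0_fin_numE.
have : leb (`[(- k%:R)%R, k%:R]%classic : set R) < +oo.
  by rewrite lebesgue_measure_itv/=; case: ifP => _; rewrite -?EFinD ltry.
exact.
Qed.

Lemma sigma_finite_lebesgue_tuple d : sigma_finite setT (lebt d).
Proof.
exists (tuple_box d) => [|k]; last by split; [exact: measurable_tuple_box|exact: lebesgue_tuple_box].
apply/esym; rewrite -subTset => x _.
pose M := (\sum_(i < d) `|tnth x i|)%R.
exists (Num.truncn M).+1 => // i /=.
rewrite (@le_trans _ _ M)//; last by rewrite ltW// truncnS_gt.
by rewrite /M (bigD1 i)//= lerDl sumr_ge0.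
Qed.


Definition tuple_dil d (c : R) (x : d.-tuple RT) : d.-tuple RT :=
  [tuple (c * tnth x i)%R | i < d].

Lemma measurable_tuple_dil d (c : R) : measurable_fun setT (@tuple_dil d c).
Proof.
apply/measurable_fun_tnthP => i.
rewrite (_ : _ \o _ = (fun x : d.-tuple RT => c * tnth x i)%R); last first.
  by apply/funext => x /=; rewrite tnth_mktuple.
apply: measurable_funM => //; exact: measurable_tnth.
Qed.

Lemma snoc_tuple_dil d c (x : d.-tuple RT) (t : RT) :
  snoc (tuple_dil c x, c * t)%R = tuple_dil c (snoc (x, t)).
Proof.
apply: eq_from_tnth => i; rewrite tnth_mktuple.
have [id|di] := ltnP i d.
  rewrite (_ : i = widen_ord (leqnSn d) (Ordinal id)); last exact: val_inj.
  by rewrite !tnth_snoc_widen tnth_mktuple.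
rewrite (_ : i = ord_max) ?tnth_snoc_max//; apply: val_inj => /=.
by apply/eqP; rewrite eqn_leq di -ltnS ltn_ord.
Qed.

Lemma ge0_integral_lebesgue_tupleS d (f : d.+1.-tuple RT -> \bar R) :
  measurable_fun setT f -> (forall x, 0 <= f x) ->
  \int[lebt d.+1]_x f x = \int[lebt d]_x \int[leb]_t f (snoc (x, t)).
Proof.
move=> mf f0; have [mu muE] := sigma_finite_measureP (@sigma_finite_lebesgue_tuple d).
(* The same measure, displayed as an image measure so that the change of variables along [snoc]
   applies. *)
pose m : {measure set (d.+1.-tuple RT) -> \bar R} :=
  measure_function_pushforward__canonical__measure_function_Measure
    (lebt d \x leb) (@measurable_snoc R d).
transitivity (\int[m]_x f x); first exact: eq_measure_integral.
rewrite ge0_integral_pushforward//=; last exact: measurable_snoc.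
rewrite preimage_setT muE (fubini_tonelli1 (f \o @snoc RT d))//.
- by apply: measurableT_comp => //; exact: measurable_snoc.
- by move=> x; exact: f0.
Qed.

(** Induction on the dimension: each coordinate undergoes a one-dimensional dilation and contributes
    a factor [c]. *)
Lemma ge0_integral_tuple_dil d (c : R) (f : d.-tuple RT -> \bar R) : (0 < c)%R ->
  measurable_fun setT f -> (forall x, 0 <= f x) ->
  \int[lebt d]_x f x = (c ^+ d)%:E * \int[lebt d]_x f (tuple_dil c x).
Proof.
move=> c0; elim: d f => [|d IH] f mf f0.
  rewrite mul1e; apply: eq_integral => x _; congr f.
  by rewrite (tuple0 x) [RHS]tuple0.
have mfs : measurable_fun setT (f \o @snoc RT d).
  by apply: measurableT_comp => //; exact: measurable_snoc.
have mfc : measurable_fun setT (f \o tuple_dil c).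
  by apply: measurableT_comp => //; exact: measurable_tuple_dil.
have [mu muE] := sigma_finite_measureP (@sigma_finite_lebesgue_tuple d).
rewrite !ge0_integral_lebesgue_tupleS//.
transitivity (\int[lebt d]_x (c%:E * \int[leb]_t f (snoc (x, c * t)%R))).
  apply: eq_integral => x _; apply: (ge0_integral_dilation c0) => //.
  by apply: (measurableT_comp mfs); exact: measurable_pair1.
have mfi : measurable_fun setT (fun x : d.-tuple RT => \int[leb]_t f (snoc (x, c * t)%R)).
  apply: (@measurable_fun_fubini_tonelli_F _ _ _ _ _ leb (fun z : d.-tuple RT * RT => f (snoc (z.1, c * z.2)%R))) => //.
  apply: (measurableT_comp mfs) => /=; apply: measurable_fun_pair => //=.
  exact: measurable_funM.
rewrite ge0_integralZl_EFin ?ltW//; last by move=> x _; exact: integral_ge0.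
rewrite (IH _ mfi); last by move=> x; exact: integral_ge0.
rewrite muleA -EFinM -exprS; congr (_ * _).
by apply: eq_integral => x _; apply: eq_integral => t _; rewrite snoc_tuple_dil.
Qed.

Lemma tuple_dilK d (t : R) : t != 0%R -> cancel (@tuple_dil d t) (tuple_dil t^-1).
Proof.
move=> t0 x; apply: eq_from_tnth => i; rewrite !tnth_mktuple.
by rewrite mulrA mulVf ?mul1r.
Qed.

Lemma ge0_integral_tuple_contract d (t : R) (f : d.-tuple RT -> \bar R) : (0 < t)%R ->
  measurable_fun setT f -> (forall x, 0 <= f x) ->
  \int[lebt d]_x f (tuple_dil t^-1 x) = (t ^+ d)%:E * \int[lebt d]_x f x.
Proof.
move=> t0 mf f0; rewrite (ge0_integral_tuple_dil t0)//; last first.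
  exact: (measurableT_comp mf (@measurable_tuple_dil d t^-1)).
congr (_ * _); apply: eq_integral => x _.
by rewrite tuple_dilK// gt_eqF.
Qed.

(** The nonnegative case is applied to the positive and negative parts; integrability lets the
    factor [t^d] distribute over their difference. *)
Lemma integral_tuple_contract d (t : R) (f : d.-tuple RT -> R) : (0 < t)%R ->
  (lebt d).-integrable setT (EFin \o f) ->
  \int[lebt d]_x (f (tuple_dil t^-1 x))%:E = (t ^+ d)%:E * \int[lebt d]_x (f x)%:E.
Proof.
move=> t0 intf; have mf := measurable_int _ intf.
pose g := EFin \o f.
have mp : measurable_fun setT g^\+ by exact: measurable_funepos.
have mn : measurable_fun setT g^\- by exact: measurable_funeneg.
rewrite [in RHS]integralE [in LHS]integralE muleBr//; last first.
  apply: fin_num_adde_defl; rewrite fin_numN.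
  by have := integrable_neg_fin_num measurableT intf.
congr (_ - _).
  have E := ge0_integral_tuple_contract t0 mp (fun x => funepos_ge0 g x).
  by etransitivity; [apply: eq_integral|exact: E] => x _; rewrite !funeposE.
have E := ge0_integral_tuple_contract t0 mn (fun x => funeneg_ge0 g x).
by etransitivity; [apply: eq_integral|exact: E] => x _; rewrite !funenegE.
Qed.

End lebesgue_tuple_theory.

(** * Separation of the height from the rescaled point of the slice *)

Section separation.
Context {R : realType}.
Local Notation RT := (measurableTypeR R).
Local Notation leb := (@lebesgue_measure R).
Local Notation lebt d := (@lebesgue_tuple R d).
Local Open Scope ereal_scope.

Variables (d : nat) (g : RT -> R) (h : d.-tuple RT -> R).
Hypothesis mg : measurable_fun setT g.
Hypothesis intg : leb.-integrable `]0%R, +oo[ (fun t => (t ^+ d * g t)%:E).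
Hypothesis inth : (lebt d).-integrable setT (EFin \o h).

(** The function [g(t) h(x/t)] on the upper half-space. With [h] extended by zero outside the ball,
    it is supported in the cone. *)
Definition cone_tensor (z : d.-tuple RT * RT) : R :=
  if (0 < z.2)%R then (g z.2 * h (tuple_dil z.2^-1 z.1))%R else 0%R.

Let mh : measurable_fun setT h.
Proof. by apply/measurable_EFinP; exact: (measurable_int _ inth). Qed.

Lemma measurable_cone_tensor : measurable_fun setT cone_tensor.
Proof.
(* The inverse is replaced by the power of exponent -1, which agrees with it for [t > 0] and is
   measurable by [measurable_powR]. *)
rewrite (_ : cone_tensor = fun z => if (0 < z.2)%R then
    (g z.2 * h (tuple_dil (z.2 `^ (-1)) z.1))%R else 0%R); last first.
  by apply/funext => z; rewrite /cone_tensor; case: ifPn => // z0; rewrite powR_inv1// ltW.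
apply: measurable_fun_ifT => //=.
  by apply: measurable_fun_ltr => //; exact: measurable_snd.
apply: measurable_funM; first exact: measurableT_comp.
apply: (measurableT_comp mh); apply/measurable_fun_tnthP => i.
rewrite (_ : _ \o _ = (fun z : d.-tuple RT * RT => z.2 `^ (-1) * tnth z.1 i)%R); last first.
  by apply/funext => x /=; rewrite tnth_mktuple.
apply: measurable_funM.
  by apply: (@measurableT_comp _ _ _ _ _ _ (@powR R ^~ (-1)%R)) => //; exact: measurable_powR.
apply: (@measurableT_comp _ _ _ _ _ _ (fun x : d.-tuple RT => tnth x i)) => //.
exact: measurable_tnth.
Qed.

Lemma integral_cone_tensor_fiber (t : R) :
  \int[lebt d]_x (cone_tensor (x, t))%:E =
  if (0 < t)%R then (t ^+ d * g t)%:E * \int[lebt d]_x (h x)%:E else 0.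
Proof.
rewrite /cone_tensor/=; case: ifPn => t0; last by rewrite integral0.
have inth' : (lebt d).-integrable setT (EFin \o (h \o tuple_dil t^-1)).
  apply/integrableP; split.
    apply/measurable_EFinP; apply: measurableT_comp => //; exact: measurable_tuple_dil.
  have mH : measurable_fun setT (abse \o (EFin \o h)).
    by apply: measurableT_comp => //; exact/measurable_EFinP.
  have := ge0_integral_tuple_contract t0 mH (fun x => abse_ge0 _) => /= ->.
  rewrite lte_mul_pinfty ?lee_fin ?exprn_ge0 ?ltW//.
  by have /integrableP[] := inth.
under eq_integral do rewrite EFinM.
rewrite integralZl//; rewrite (integral_tuple_contract t0 inth) muleA -EFinM.
by rewrite mulrC.
Qed.

Lemma integral_cone_tensor_fiber_abs (t : R) :
  \int[lebt d]_x `|(cone_tensor (x, t))%:E| =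
  if (0 < t)%R then (t ^+ d * `|g t|)%:E * \int[lebt d]_x `|(h x)%:E| else 0.
Proof.
rewrite /cone_tensor/=; case: ifPn => t0; last by rewrite integral0_eq// => x _; rewrite normr0.
have mH : measurable_fun setT (abse \o (EFin \o h)).
  by apply: measurableT_comp => //; exact/measurable_EFinP.
under eq_integral do rewrite normrM EFinM.
rewrite ge0_integralZl_EFin//; last first.
  exact: (measurableT_comp mH (@measurable_tuple_dil R d t^-1)).
have := ge0_integral_tuple_contract t0 mH (fun x => abse_ge0 _) => /= ->.
by rewrite muleA -EFinM mulrC.
Qed.

(** By Tonelli's theorem a finite iterated integral of the absolute value is enough, and on slices
    this factors into the finite integrals of [t^d |g|] and of [|h|]. *)
Lemma integrable_cone_tensor :
  (lebt d \x leb).-integrable setT (EFin \o cone_tensor).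
Proof.
have key : \int[leb]_t \int[lebt d]_x `|(cone_tensor (x, t))%:E| < +oo.
  under eq_integral do rewrite integral_cone_tensor_fiber_abs.
  have /integrableP[_ hlty] := inth; have /integrableP[mg' glty] := intg.
  rewrite (_ : \int[_]_t _ = \int[leb]_(t in `]0%R, +oo[)
      (`|(t ^+ d * g t)%:E| * \int[lebt d]_x `|(h x)%:E|)); last first.
    rewrite [RHS]integral_mkcond; apply: eq_integral => t _.
    rewrite patchE mem_setE in_itv/= andbT; case: ifPn => // t0.
    by rewrite normrM (ger0_norm (exprn_ge0 _ (ltW t0))).
  rewrite ge0_integralZr//; last 2 first.
  - by apply: measurableT_comp => //.
  - exact: integral_ge0.
  by rewrite lte_mul_pinfty ?integral_ge0// ge0_fin_numE// integral_ge0.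
have [mu muE] := sigma_finite_measureP (@sigma_finite_lebesgue_tuple R d).
move: key; rewrite muE => key; apply/integrable21ltyP; last exact: key.
by apply/measurable_EFinP; exact: measurable_cone_tensor.
Qed.

Lemma integral_cone_tensor :
  \int[lebt d \x leb]_z (cone_tensor z)%:E =
  \int[leb]_(t in `]0%R, +oo[) (t ^+ d * g t)%:E * \int[lebt d]_x (h x)%:E.
Proof.
transitivity (\int[leb]_t \int[lebt d]_x (cone_tensor (x, t))%:E).
  have [mu muE] := sigma_finite_measureP (@sigma_finite_lebesgue_tuple R d).
  have := integrable_cone_tensor; rewrite muE => ints.
  exact/esym/(integral21_prod_meas1 ints).
under eq_integral do rewrite integral_cone_tensor_fiber.
rewrite (_ : \int[_]_t _ = \int[leb]_(t in `]0%R, +oo[)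
    ((t ^+ d * g t)%:E * \int[lebt d]_x (h x)%:E)); last first.
  rewrite [RHS]integral_mkcond; apply: eq_integral => t _.
  by rewrite patchE mem_setE in_itv/= andbT.
have /fineK <- := integrable_fin_num measurableT inth.
by rewrite integralZr.
Qed.

End separation.

(** * The cone and its weight under the substitution [x = t y] *)

Section cone_integral.
Context {R : realType}.
Local Notation RT := (measurableTypeR R).
Local Notation leb := (@lebesgue_measure R).
Local Notation lebt d := (@lebesgue_tuple R d).
Implicit Types (p q mu : R) (d : nat).

Lemma measurable_meval d (P : {mpoly R[d]}) :
  measurable_fun setT (fun x : d.-tuple RT => P.@[tnth x]).
Proof.
rewrite (_ : (fun x => _) = (fun x : d.-tuple RT =>
  \sum_(m <- msupp P) mcoeff m P * \prod_i tnth x i ^+ m i)); last first.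
  by apply/funext => x; rewrite mevalE.
apply: measurable_sum => m; apply: measurable_funM => //.
apply: measurable_prod => i _; apply: measurable_funX; exact: measurable_tnth.
Qed.

Lemma measurable_sqnorm d : measurable_fun setT (@sqnorm R d).
Proof.
apply: measurable_sum => i; apply: measurable_funX; exact: measurable_tnth.
Qed.

Lemma sqnorm_ge0 d (x : d.-tuple R) : 0 <= sqnorm x.
Proof. by apply: sumr_ge0 => i _; exact: sqr_ge0. Qed.

Lemma sqrt_leP (s t : R) : 0 <= s -> (Num.sqrt s <= t) = (0 <= t) && (s <= t ^+ 2).
Proof.
move=> s0; apply/idP/andP => [st|[t0 st]].
  have t0 : 0 <= t by apply: le_trans st; exact: sqrtr_ge0.
  by split=> //; rewrite -(sqr_sqrtr s0) lerXn2r// nnegrE ?sqrtr_ge0.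
by rewrite -(ger0_norm t0) -sqrtr_sqr ler_wsqrtr.
Qed.

Lemma measurable_ball_set d : measurable (@ball_set R d).
Proof.
have -> : @ball_set R d = [set x : d.-tuple RT | sqnorm x <= 1].
  by apply/seteqP; split => x; rewrite /ball_set/= sqrt_leP ?sqnorm_ge0// ler01 expr1n.
rewrite -[X in measurable X]setTI.
by apply: measurable_fun_le => //; exact: measurable_sqnorm.
Qed.

Lemma measurable_cone_set d : measurable (@cone_set R d).
Proof.
have -> : @cone_set R d = [set z : d.-tuple RT * RT | 0 <= z.2] `&` [set z | sqnorm z.1 <= z.2 ^+ 2].
  apply/seteqP; split => z; rewrite /cone_set/= sqrt_leP ?sqnorm_ge0//.
    by move=> /andP.
  by move=> /andP.
apply: measurableI; rewrite -[X in measurable X]setTI; apply: measurable_fun_le => //.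
- by apply: measurableT_comp => //; exact: measurable_sqnorm.
- exact: measurable_funX.
Qed.

Lemma measurable_ball_weight d mu : measurable_fun setT (@ball_weight R d mu).
Proof.
apply: (@measurableT_comp _ _ _ _ _ _ (@powR R ^~ (mu - 2^-1))); first exact: measurable_powR.
by apply: measurable_funB => //; exact: measurable_sqnorm.
Qed.

Lemma measurable_cone_weight d p q mu :
  measurable_fun setT (fun z : d.-tuple RT * RT => cone_weight p q mu z.1 z.2).
Proof.
apply: measurable_funM.
  apply: (@measurableT_comp _ _ _ _ _ _ (@powR R ^~ (mu - 2^-1))); first exact: measurable_powR.
  apply: measurable_funB; first exact: measurable_funX.
  by apply: measurableT_comp => //; exact: measurable_sqnorm.
rewrite (_ : (fun z => _) = (fun z : d.-tuple RT * RT => beta_weight q (p + q) z.2)).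
  by apply: (measurableT_comp (measurable_beta_weight _ _)).
by apply/funext => z; rewrite /beta_weight powRN.
Qed.

Lemma measurable_poly_weight a s (G : {poly R}) :
  measurable_fun setT (poly_weight a s G).
Proof.
apply: measurable_funM; first exact: measurable_beta_weight.
by apply: continuous_measurable_fun; exact: continuous_horner.
Qed.

Lemma sqnorm_dil d (c : R) (x : d.-tuple RT) : sqnorm (tuple_dil c x) = c ^+ 2 * sqnorm x.
Proof.
rewrite /sqnorm mulr_sumr; apply: eq_bigr => i _.
by rewrite tnth_mktuple exprMn.
Qed.

Lemma cone_dil d (x : d.-tuple RT) (t : R) : 0 < t ->
  (Num.sqrt (sqnorm x) <= t) = (Num.sqrt (sqnorm (tuple_dil t^-1 x)) <= 1).
Proof.
move=> t0; rewrite !sqrt_leP ?sqnorm_ge0// ler01 (ltW t0)/= expr1n sqnorm_dil.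
by rewrite exprVn mulrC ler_pdivrMr ?exprn_gt0// mul1r.
Qed.

(** On the cone [t^2 - |x|^2 = t^2 (1 - |x/t|^2)], and the power of [t^2] adds [2 mu - 1] to the
    exponent [q]. *)
Lemma cone_weight_dil d p q mu (x : d.-tuple RT) (t : R) : 0 < t ->
  Num.sqrt (sqnorm x) <= t ->
  cone_weight p q mu x t = beta_weight (q + 2 * mu - 1) (p + q) t * ball_weight mu (tuple_dil t^-1 x).
Proof.
move=> t0 xt; have := xt; rewrite cone_dil// sqrt_leP ?sqnorm_ge0// ler01/= expr1n => x1.
rewrite /cone_weight /ball_weight.
have -> : t ^+ 2 - sqnorm x = t ^+ 2 * (1 - sqnorm (tuple_dil t^-1 x)).
  rewrite sqnorm_dil mulrBr mulr1 mulrA exprVn mulfV ?mul1r//.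
  by rewrite expf_neq0// gt_eqF.
rewrite powRM ?sqr_ge0 ?subr_ge0//.
rewrite /beta_weight -powR_mulrn ?ltW// -powRrM powRN.
have -> : q + 2 * mu - 1 = 2%:R * (mu - 2^-1) + q by field.
rewrite (@powRD _ t _ q) ?(gt_eqF t0) ?implybT//.
move: (t `^ (_ * _)) ((1 - _) `^ _) (t `^ q) ((1 + t) `^ _) => a b c e.
ring.
Qed.

Section cone_polar.
Variables (d m : nat) (p q mu : R) (G : {poly R}) (Q : {mpoly R[d]}).
Variable F : d.-tuple RT * RT -> R.
(** The total exponent of [t]: [q + 2 mu - 1] from the weight, [m] from the homogeneous factor and
    [d] from the substitution, where [2 alpha = 2 mu + d - 1]. *)
Let q' := q + 2 * alpha_ d mu + m%:R.
Let hball (x : d.-tuple RT) : R := Q.@[tnth x] * ball_weight mu x.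
Hypothesis FE : forall x (t : R), 0 < t ->
  F (x, t) = G.[t] * (t ^+ m * Q.@[tnth (tuple_dil t^-1 x)]).
Hypothesis mF : measurable_fun setT F.
Hypothesis q'0 : 0 < q' + 1.
Hypothesis q'G : q' + (size G)%:R < p + q.
Hypothesis iQ : (lebt d).-integrable (@ball_set R d) (EFin \o hball).

Let g := poly_weight (q + 2 * mu - 1 + m%:R) (p + q) G.
Let h : d.-tuple RT -> R := hball \_ (@ball_set R d).
Let f := fun z => F z * cone_weight p q mu z.1 z.2.

Let mg : measurable_fun setT g. Proof. exact: measurable_poly_weight. Qed.

Let powE (t : R) : 0 < t -> t ^+ d * g t = poly_weight q' (p + q) G t.
Proof.
move=> t0; rewrite /g /poly_weight mulrA [t ^+ d * _]mulrC beta_weightXn//.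
by congr (beta_weight _ _ _ * _); rewrite /q' /alpha_; field.
Qed.

Let intg : leb.-integrable `]0, +oo[ (fun t => (t ^+ d * g t)%:E).
Proof.
have := integrable_poly_weight_wide q'0 q'G (leqnn _).
apply: eq_integrable => // t; rewrite inE/= in_itv/= andbT => t0.
by rewrite powE.
Qed.

Let inth : (lebt d).-integrable setT (EFin \o h).
Proof.
rewrite (_ : EFin \o h = (EFin \o hball) \_ (@ball_set R d)); last exact/esym/restrict_EFin.
exact: (integrable_mkcond _ (@measurable_ball_set d)).1 iQ.
Qed.

Let restrE (z : d.-tuple RT * RT) : z.2 != (0 : R) -> (f \_ (@cone_set R d)) z = cone_tensor g h z.
Proof.
case: z => x t /= t0; rewrite /cone_tensor/= patchE.
case: ltrP => [{}t0|tle]; last first.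
  rewrite memNset// /cone_set/= sqrt_leP ?sqnorm_ge0// => /andP[t0' _].
  by move: t0; rewrite eq_le tle t0'.
rewrite /h patchE.
have -> : ((x, t) \in @cone_set R d) = (tuple_dil t^-1 x \in @ball_set R d).
  by apply/idP/idP; rewrite !inE /cone_set /ball_set /= (cone_dil _ t0).
case: ifPn => [|_]; last by rewrite mulr0.
rewrite inE /ball_set/= -cone_dil// => xt.
rewrite /f/= FE// cone_weight_dil// /g /poly_weight -beta_weightXn// /hball; ring.
Qed.

Let mrestr : measurable_fun setT (f \_ (@cone_set R d)).
Proof.
apply/(measurable_restrictT _ (@measurable_cone_set d)); apply: measurable_funTS.
by apply: measurable_funM => //; exact: measurable_cone_weight.
Qed.

(** At the apex of the cone, where [t = 0], the formula [FE] says nothing. The two functions agree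
    off the hyperplane [t = 0], which is a null set. *)
Let restr_ae : ae_eq (lebt d \x leb)%E setT (EFin \o (f \_ (@cone_set R d))) (EFin \o cone_tensor g h).
Proof.
exists ([set: d.-tuple RT] `*` [set 0 : RT]); split.
- by apply: measurableX.
- transitivity (lebt d setT * leb [set 0%R])%E; first exact: product_measure1E.
  by rewrite lebesgue_measure_set1 mule0.
- move=> z /=; apply: contra_notP => /not_andP[//|] z0 _; congr EFin.
  by apply: restrE; apply/eqP.
Qed.

Lemma integrable_cone_polar :
  (lebt d \x leb)%E.-integrable (@cone_set R d) (EFin \o f).
Proof.
apply: (integrable_mkcond _ (@measurable_cone_set d)).2; rewrite restrict_EFin.
apply/integrableP; split; first exact/measurable_EFinP.
have /integrableP[ms] := integrable_cone_tensor mg intg inth.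
apply: le_lt_trans; rewrite le_eqVlt; apply/orP; left; apply/eqP.
apply: ae_eq_integral => //.
- by apply: measurableT_comp => //; exact/measurable_EFinP.
- exact: measurableT_comp.
- by apply: filterS restr_ae => z /(_ Logic.I) [E] _ /=; rewrite E.
Qed.

Lemma integral_cone_polar :
  (\int[lebt d \x leb]_(z in @cone_set R d) (f z)%:E =
   (beta_int q' (p + q) G)%:E * \int[lebt d]_(x in @ball_set R d) (hball x)%:E)%E.
Proof.
transitivity (\int[lebt d \x leb]_z (cone_tensor g h z)%:E)%E.
  rewrite integral_mkcond restrict_EFin; apply: ae_eq_integral => //.
  - exact/measurable_EFinP.
  - by apply/measurable_EFinP; exact: (measurable_cone_tensor mg inth).
rewrite (integral_cone_tensor mg intg inth); congr (_ * _)%E.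
  rewrite /beta_int /Rintegral fineK; last first.
    apply: integrable_fin_num => //.
    exact: (integrable_poly_weight_wide q'0 q'G (leqnn _)).
  apply: eq_integral => t; rewrite inE/= in_itv/= andbT => t0.
  by rewrite powE.
rewrite [RHS]integral_mkcond; apply: eq_integral => x _.
by rewrite /h !patchE; case: ifP.
Qed.

End cone_polar.

End cone_integral.

(** * The orthogonality relation on the cone *)

Section fin_num_integrable.
Context {dd : measure_display} {T : measurableType dd} {R : realType}.
Variables (m : {measure set T -> \bar R}) (D : set T) (f : T -> \bar R).

(** The integral is a difference of two nonnegative extended reals, which is finite only if both
    are. This extracts convergence from the equations assumed of the inner products. *)
Lemma fin_num_integrable : measurable D -> measurable_fun D f ->
  (\int[m]_(x in D) f x)%E \is a fin_num -> m.-integrable D f.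
Proof.
move=> mD mf fin; apply/integrableP; split => //.
have mp : measurable_fun D f^\+%E by exact: measurable_funepos.
have mn : measurable_fun D f^\-%E by exact: measurable_funeneg.
have -> : (\int[m]_(x in D) `|f x| = \int[m]_(x in D) (f^\+ x) + \int[m]_(x in D) (f^\- x))%E.
  rewrite -ge0_integralD//; apply: eq_integral => x _.
  exact: (congr1 (fun h => h x) (fune_abse f)).
move: fin; rewrite integralE.
have : (0 <= \int[m]_(x in D) (f^\+ x))%E by exact: integral_ge0.
have : (0 <= \int[m]_(x in D) (f^\- x))%E by exact: integral_ge0.
case: (integral m D f^\+%E) => [x| |] //; case: (integral m D f^\-%E) => [y| |] //.
by rewrite -EFinD ltry.
Qed.

End fin_num_integrable.

Section evaluation.
Context {R : realType}.
Local Notation RT := (measurableTypeR R).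

Lemma meval_horner_tvar d (M : {poly R}) (x : d.-tuple R) (t : R) :
  (horner_alg (tvar d) M).@[tnth (snoc (x, t))] = M.[t].
Proof.
elim/poly_ind: M => [|M c IH]; first by rewrite rmorph0 meval0 horner0.
rewrite !(rmorphD, rmorphM)/= horner_algX horner_algC IH.
rewrite hornerD hornerM hornerX hornerC /tvar mevalXU.
rewrite (_ : tnth _ ord_max = t); last first.
  by rewrite (tnth_nth t)/= nth_rcons size_tuple ltnn eqxx.
by rewrite mevalZ meval1 mulr1.
Qed.

Lemma meval_coneM d (p q mu : R) (P : multinom d -> {mpoly R[d]}) n k
    (x : d.-tuple RT) (t : R) :
  (msize (P k) <= (mdeg k).+1)%N -> 0 < t ->
  (coneM p q mu P n k).@[tnth (snoc (x, t))] =
  (M_ (n - mdeg k) (p - 2 * alpha_ d mu - 2 * (mdeg k)%:R)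
     (q + 2 * alpha_ d mu + 2 * (mdeg k)%:R)).[t] *
  (t ^+ mdeg k * (P k).@[tnth (tuple_dil t^-1 x)]).
Proof.
move=> Pk t0; rewrite /coneM mevalM meval_horner_tvar homogenizeE ?gt_eqF//.
congr (_ * (_ * _)); congr (meval _ _); apply/funext => i.
by rewrite tnth_mktuple mulrC.
Qed.

End evaluation.

Section orthonormal_ball.
Context {R : realType}.
Local Notation RT := (measurableTypeR R).
Local Notation lebt d := (@lebesgue_tuple R d).
Variables (d : nat) (mu : R) (P : multinom d -> {mpoly R[d]}).
Hypothesis orthoP : forall m : nat,
     is_orthonormal_basis (@ball_ip R d mu)
       (fun k : bmultinom d m.+1 => mdeg k == m)
       (fun k : bmultinom d m.+1 => P k)
       (orthopoly_space (@ball_ip R d mu) m).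

Lemma orthonormal_mem k : orthopoly_space (@ball_ip R d mu) (mdeg k) (P k).
Proof.
have [[mem _ _] _] := orthoP (mdeg k).
exact: (mem (BMultinom (ltnSn (mdeg k))) (eqxx _)).
Qed.

Lemma ball_ipC (f g : {mpoly R[d]}) : ball_ip mu f g = ball_ip mu g f.
Proof. by rewrite /ball_ip; congr (_ * _)%E; apply: eq_integral => x _; rewrite (mulrC f.@[_]). Qed.

(** In equal degrees this is orthonormality of the chosen basis; otherwise the polynomial of higher
    degree is orthogonal to everything of lower degree. *)
Lemma ball_ipP k k' : ball_ip mu (P k) (P k') = ((k == k')%:R)%:E.
Proof.
have [kk'|] := eqVneq (mdeg k) (mdeg k').
  have k'k : (mdeg k' < (mdeg k).+1)%N by rewrite kk'.
  have [_ O] := orthoP (mdeg k).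
  exact: (O (BMultinom (ltnSn (mdeg k))) (BMultinom k'k) (eqxx _) (introT eqP (esym kk'))).
wlog : k k' / (mdeg k' < mdeg k)%N.
  move=> W; rewrite neq_ltn => /orP[kk'|k'k].
    by rewrite ball_ipC eq_sym W// gt_eqF.
  by rewrite W// gt_eqF.
move=> k'k kk'; have [_ /(_ (P k'))] := orthonormal_mem k.
case: (eqVneq k k') kk' => [->|_ _ ->//]; first by rewrite eqxx.
by have [/leq_trans + _] := orthonormal_mem k'; apply.
Qed.

(** A zero constant would contradict that [P 0] has norm 1. *)
Lemma b_ball_neq0 : b_ball d mu != 0.
Proof.
apply/eqP => b0; have := ball_ipP (@mnm0 d) (@mnm0 d).
by rewrite /ball_ip b0 mul0e eqxx => /eqP; rewrite eqe eq_sym oner_eq0.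
Qed.

(** A nonzero constant times an infinite integral would be infinite, whereas [ball_ipP] gives a real
    value. *)
Lemma integrable_ball_PP k k' : (lebt d).-integrable (@ball_set R d)
  (EFin \o (fun x => (P k * P k').@[tnth x] * ball_weight mu x)).
Proof.
apply: fin_num_integrable; first exact: measurable_ball_set.
  apply/measurable_EFinP; apply: measurable_funTS; apply: measurable_funM.
    exact: measurable_meval.
  exact: measurable_ball_weight.
have := ball_ipP k k'; rewrite /ball_ip.
have -> : (\int[lebt d]_(x in @ball_set R d)
    (EFin \o (fun x => (P k * P k').@[tnth x] * ball_weight mu x)%R) x =
  \int[lebt d]_(x in @ball_set R d)
    ((P k).@[tnth x] * (P k').@[tnth x] * ball_weight mu x)%:E)%E.
  by apply: eq_integral => x _; rewrite /= mevalM.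
case: (integral _ _ _) => [x _ //| |].
  by rewrite mulry; case: sgrP b_ball_neq0 => //; rewrite ?mul1e ?mulN1e.
by rewrite mulrNy; case: sgrP b_ball_neq0 => //; rewrite ?mul1e ?mulN1e.
Qed.


Lemma integral_ball_PP k k' :
  ((b_ball d mu)%:E * \int[lebt d]_(x in @ball_set R d)
    ((P k * P k').@[tnth x] * ball_weight mu x)%:E = ((k == k')%:R)%:E)%E.
Proof.
rewrite -ball_ipP /ball_ip; congr (_ * _)%E; apply: eq_integral => x _.
by rewrite mevalM.
Qed.

(** * Inner products of the cone polynomials *)

Section cone_relation.
Variables (p q : R) (n n' : nat).
Hypothesis np : 2 * (maxn n n')%:R + 2 * mu + d%:R < p.
Hypothesis q0 : - 2 * mu - d%:R < q.
Local Notation coneP := (coneM p q mu P).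
Local Notation leb := (@lebesgue_measure R).

Let alphaE : 2 * alpha_ d mu = 2 * mu + d%:R - 1.
Proof. by rewrite /alpha_; field. Qed.

Let weight_poly (k k' : multinom d) : {poly R} :=
  M_ (n - mdeg k) (p - 2 * alpha_ d mu - 2 * (mdeg k)%:R)
     (q + 2 * alpha_ d mu + 2 * (mdeg k)%:R) *
  M_ (n' - mdeg k') (p - 2 * alpha_ d mu - 2 * (mdeg k')%:R)
     (q + 2 * alpha_ d mu + 2 * (mdeg k')%:R).

Let size_weight_poly k k' : (mdeg k <= n)%N -> (mdeg k' <= n')%N ->
  (size (weight_poly k k') + mdeg k + mdeg k' <= n + n' + 1)%N.
Proof.
move=> kn kn'; rewrite /weight_poly.
set A := M_ _ _ _; set B := M_ _ _ _.
have sA : (size A <= (n - mdeg k).+1)%N by exact: size_M.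
have sB : (size B <= (n' - mdeg k').+1)%N by exact: size_M.
by have := size_polyMleq A B; move: sA sB; lia.
Qed.

Lemma meval_coneMM k k' (x : d.-tuple RT) (t : R) : 0 < t ->
  (coneP n k * coneP n' k').@[tnth (snoc (x, t))] =
  (weight_poly k k').[t] * (t ^+ (mdeg k + mdeg k') * (P k * P k').@[tnth (tuple_dil t^-1 x)]).
Proof.
move=> t0; have [Pk _] := orthonormal_mem k; have [Pk' _] := orthonormal_mem k'.
by rewrite mevalM !meval_coneM// /weight_poly hornerM mevalM exprD; ring.
Qed.

Let measurable_coneMM k k' : measurable_fun setT
  (fun z : d.-tuple RT * RT => (coneP n k * coneP n' k').@[tnth (snoc z)]).
Proof. by apply: (measurableT_comp (measurable_meval _)); exact: measurable_snoc. Qed.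

(** Since [2 alpha + 1 = 2 mu + d], the case of degrees 0 is exactly the hypothesis on [q]. *)
Let exp_gt0 (k k' : multinom d) : 0 < q + 2 * alpha_ d mu + (mdeg k + mdeg k')%:R + 1.
Proof. by have := ler0n R (mdeg k + mdeg k'); rewrite alphaE; move: q0; lra. Qed.

(** The degree count leaves at most [2N + 1], with [N] the larger of [n] and [n']; adding
    [2 alpha = 2 mu + d - 1] gives precisely the lower bound assumed on [p]. *)
Let exp_size k k' : (mdeg k <= n)%N -> (mdeg k' <= n')%N ->
  q + 2 * alpha_ d mu + (mdeg k + mdeg k')%:R + (size (weight_poly k k'))%:R < p + q.
Proof.
move=> kn kn'; have s := size_weight_poly kn kn'.
have : (mdeg k + mdeg k')%:R + (size (weight_poly k k'))%:R <= 2 * (maxn n n')%:R + 1 :> R.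
  by rewrite -natrM natr1 -natrD ler_nat; move: s; lia.
by rewrite alphaE; move: np; lra.
Qed.

Lemma integrable_coneMM k k' : (mdeg k <= n)%N -> (mdeg k' <= n')%N ->
  (lebt d \x leb)%E.-integrable (@cone_set R d)
    (EFin \o (fun z => (coneP n k * coneP n' k').@[tnth (snoc z)] * cone_weight p q mu z.1 z.2)).
Proof.
move=> kn kn'.
exact: (integrable_cone_polar (@meval_coneMM k k') (measurable_coneMM k k')
  (exp_gt0 k k') (exp_size kn kn') (integrable_ball_PP k k')).
Qed.

Lemma cone_ip_coneM k k' : (mdeg k <= n)%N -> (mdeg k' <= n')%N ->
  cone_ip p q mu (coneP n k) (coneP n' k') =
  (H_ d p q mu (mdeg k) n * (n == n')%:R * (k == k')%:R)%:E.
Proof.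
move=> kn kn'; rewrite /cone_ip.
transitivity ((b_cone d p q mu)%:E * \int[lebt d \x leb]_(z in @cone_set R d)
  ((coneP n k * coneP n' k').@[tnth (snoc z)] * cone_weight p q mu z.1 z.2)%:E)%E.
  by congr (_ * _)%E; apply: eq_integral => z _; rewrite [in RHS]mevalM.
rewrite (integral_cone_polar (@meval_coneMM k k') (measurable_coneMM k k')
  (exp_gt0 k k') (exp_size kn kn') (integrable_ball_PP k k')).
(* Pairs the constant of the ball with the ball integral, which becomes the Kronecker delta, and
   [c_] with the Beta integral. *)
rewrite /b_cone EFinM [X in (_ * X)%E]muleC muleACA integral_ball_PP -!EFinM; congr EFin.
case: (eqVneq k k') kn' => [<-|_] kn'; last by rewrite mulr0 mul0r.
rewrite mul1r mulr1.
rewrite (_ : p - 2 * mu - d%:R + 1 = p - 2 * alpha_ d mu); last by rewrite alphaE; ring.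
rewrite (_ : q + 2 * mu + d%:R - 1 = q + 2 * alpha_ d mu); last by rewrite alphaE; ring.
rewrite /H_ /weight_poly.
set m := mdeg k in kn kn' *.
(* Since [p' + q' = p + q] and the exponent of [t] equals [q'], the remaining weight is the one for
   which the univariate factors of parameters [p'], [q'] are orthogonal. *)
set p' := p - 2 * alpha_ d mu - 2 * m%:R; set q' := q + 2 * alpha_ d mu + 2 * m%:R.
have -> : q + 2 * alpha_ d mu + (m + m)%:R = q' by rewrite natrD /q'; ring.
have -> : p + q = p' + q' by rewrite /p' /q'; ring.
have m0 := ler0n R m.
rewrite beta_int_MM; last 2 first.
- by rewrite /q' alphaE; move: q0; lra.
- have : (maxn (n - m) (n' - m))%:R + m%:R <= (maxn n n')%:R :> R.
    by rewrite -natrD ler_nat; move: kn kn'; lia.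
  by rewrite /p' alphaE; move: np; lra.
have -> : (n - m == n' - m)%N = (n == n').
  by apply/eqP/eqP => [|->//]; move: kn kn'; lia.
move: (c_ _ _) (c_ _ _) (h_ _ _ _) (_ == _) => a b c e; ring.
Qed.

End cone_relation.

End orthonormal_ball.

(** * Spanning by a counting argument *)

Section cone_basis.
Context {R : realType}.
Local Notation RT := (measurableTypeR R).
Local Notation lebt d := (@lebesgue_tuple R d).
Local Notation leb := (@lebesgue_measure R).

Lemma msize_horner_tvar d (M : {poly R}) n : (size M <= n)%N ->
  (msize (horner_alg (tvar d) M) <= n)%N.
Proof.
move=> Mn; rewrite -(coefK M) poly_def raddf_sum/=.
apply: (leq_trans (msize_sum _ _ _)); apply/bigmax_leqP => i _.
rewrite linearZ/=. rewrite -scalerAl mul1r (leq_trans (msizeZ_le _ _))// rmorphXn/= horner_algX.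
rewrite /tvar mpolyXn msizeX mdegMn mdeg1 mul1n (leq_trans _ Mn)//.
Qed.

Lemma msize_homogenize d m (P : {mpoly R[d]}) : (msize P <= m.+1)%N ->
  (msize (homogenize m P) <= m.+1)%N.
Proof.
move=> Pm; rewrite /homogenize big_seq.
apply: (leq_trans (msize_sum _ _ _)); apply/bigmax_leqP_seq => k _ kP.
rewrite (leq_trans (msizeZ_le _ _))// msizeX ltnS mdegE big_ord_recr/=.
have km : (mdeg k <= m)%N by rewrite -ltnS (leq_trans _ Pm)// msize_mdeg_lt.
rewrite !multinomE (tnth_nth 0%N) /= nth_rcons size_tuple ltnn eqxx.
rewrite (eq_bigr (fun i : 'I_d => k i)) -?mdegE ?subnKC// => i _.
by rewrite multinomE mnm_tnth !(tnth_nth 0%N)/= nth_rcons size_tuple ltn_ord.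
Qed.

Variables (d : nat) (mu : R) (P : multinom d -> {mpoly R[d]}).
Hypothesis orthoP : forall m : nat,
     is_orthonormal_basis (@ball_ip R d mu)
       (fun k : bmultinom d m.+1 => mdeg k == m)
       (fun k : bmultinom d m.+1 => P k)
       (orthopoly_space (@ball_ip R d mu) m).
Variables (p q : R) (N : nat).
Hypothesis Np : 2 * N%:R + 2 * mu + d%:R < p.
Hypothesis q0 : - 2 * mu - d%:R < q.
Local Notation coneP := (coneM p q mu P).
Local Notation ip := (@cone_ip R d p q mu).

Lemma msize_coneM n k : (mdeg k <= n)%N -> (msize (coneP n k) <= n.+1)%N.
Proof.
move=> kn; rewrite /coneM; set A := horner_alg _ _; set B := homogenize _ _.
have [Pk _] := orthonormal_mem orthoP k.
have sA : (msize A <= (n - mdeg k).+1)%N by apply: msize_horner_tvar; exact: size_M.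
have sB : (msize B <= (mdeg k).+1)%N by exact: msize_homogenize.
have [->|A0] := eqVneq A 0; first by rewrite mul0r msize0.
have [->|B0] := eqVneq B 0; first by rewrite mulr0 msize0.
rewrite msizeM//; move: (msize A) (msize B) (mdeg k) kn sA sB => a b m; lia.
Qed.

Lemma H_gt0 n m : (n <= N)%N -> (m <= n)%N -> 0 < H_ d p q mu m n.
Proof.
move=> nN mn; have alphaE : 2 * alpha_ d mu = 2 * mu + d%:R - 1 by rewrite /alpha_; field.
have nN' : n%:R <= N%:R :> R by rewrite ler_nat.
have mn' : (n - m)%:R + m%:R = n%:R :> R by rewrite -natrD subnK.
have m0 := ler0n R m; have n0 := ler0n R (n - m).
rewrite /H_ alphaE; apply: mulr_gt0; last by apply: h_gt0; move: Np q0; lra.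
by apply: divr_gt0; apply: c_gt0; move: Np q0; lra.
Qed.

Definition mnm_front (k : multinom d.+1) : multinom d :=
  Multinom [tuple k (widen_ord (leqnSn d) i) | i < d].

Lemma mdeg_front k : mdeg k = (mdeg (mnm_front k) + k ord_max)%N.
Proof.
rewrite mdegE big_ord_recr/= mdegE; congr addn.
by apply: eq_bigr => i _; rewrite multinomE tnth_mktuple.
Qed.

(* Indexes all the M_{k,j} at once: (k, j - |k|) is an exponent of degree j in
   the variables (x, t). *)
Definition cone_poly (k : multinom d.+1) : {mpoly R[d.+1]} :=
  coneP (mdeg k) (mnm_front k).

Lemma mnm_front_inj (k k' : multinom d.+1) :
  mdeg k = mdeg k' -> mnm_front k = mnm_front k' -> k = k'.
Proof.
move=> e f; apply/mnmP => i.
have [id|di] := ltnP i d.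
  have /mnmP/(_ (Ordinal id)) := f; rewrite !multinomE !tnth_mktuple.
  by rewrite (_ : widen_ord _ _ = i)//; exact: val_inj.
have -> : i = ord_max by apply/val_inj/eqP; rewrite eqn_leq di -ltnS ltn_ord.
by move: e; rewrite !mdeg_front f => /addnI.
Qed.

Lemma mdeg_front_le k : (mdeg (mnm_front k) <= mdeg k)%N.
Proof. by rewrite [leqRHS]mdeg_front leq_addr. Qed.

Let cond (k k' : multinom d.+1) : (mdeg k <= N)%N -> (mdeg k' <= N)%N ->
  2 * (maxn (mdeg k) (mdeg k'))%:R + 2 * mu + d%:R < p.
Proof.
move=> kN k'N; apply: le_lt_trans Np.
by rewrite !lerD2r ler_pM2l ?ltr0n// ler_nat geq_max kN.
Qed.

Definition cone_norm (k : multinom d.+1) : R := H_ d p q mu (mdeg (mnm_front k)) (mdeg k).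

Lemma cone_norm_gt0 k : (mdeg k <= N)%N -> 0 < cone_norm k.
Proof. by move=> kN; rewrite H_gt0 ?mdeg_front_le. Qed.

(** An exponent in [d + 1] variables is determined by its degree and its first [d] entries, so the
    two deltas of [cone_ip_coneM] merge into one. *)
Lemma cone_ip_cone_poly k k' : (mdeg k <= N)%N -> (mdeg k' <= N)%N ->
  ip (cone_poly k) (cone_poly k') = (cone_norm k' * (k == k')%:R)%:E.
Proof.
move=> kN k'N; rewrite (cone_ip_coneM orthoP (cond kN k'N) q0) ?mdeg_front_le//.
congr EFin; have [->|] := eqVneq k k'; first by rewrite !eqxx !mulr1.
move: (cone_norm k') (H_ _ _ _ _ _ _) => h h'.
have [e|_] := eqVneq (mdeg k) (mdeg k'); last by rewrite mulr0 mul0r mulr0.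
have [f|_] := eqVneq (mnm_front k) (mnm_front k'); last by rewrite !mulr0.
by rewrite (mnm_front_inj e f) eqxx.
Qed.

Lemma cone_ipC f g : ip f g = ip g f.
Proof. by rewrite /cone_ip; congr (_ * _)%E; apply: eq_integral => x _; rewrite (mulrC f.@[_]). Qed.

(** An extended-real inner product is additive only where the integrals converge;
    [integrable_coneMM] provides this for each term of the combination. *)
Lemma cone_ip_sum (I : finType) (kk : I -> multinom d.+1) (c : I -> R) k' :
  (forall i, (mdeg (kk i) <= N)%N) -> (mdeg k' <= N)%N ->
  ip (\sum_i c i *: cone_poly (kk i)) (cone_poly k') =
  (\sum_i c i * (cone_norm k' * (kk i == k')%:R))%:E.
Proof.
move=> kN k'N.
pose F k (z : d.-tuple RT * RT) : R := (cone_poly k * cone_poly k').@[tnth (snoc z)] * cone_weight p q mu z.1 z.2.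
have intF k : (mdeg k <= N)%N ->
    (lebt d \x leb)%E.-integrable (@cone_set R d) (EFin \o F k).
  by move=> kN'; apply: (integrable_coneMM orthoP (cond kN' k'N) q0); exact: mdeg_front_le.
have ipE k : (mdeg k <= N)%N -> ((b_cone d p q mu)%:E *
    \int[lebt d \x leb]_(z in @cone_set R d) (F k z)%:E)%E = (cone_norm k' * (k == k')%:R)%:E.
  move=> kN'; rewrite -cone_ip_cone_poly// /cone_ip; congr (_ * _)%E.
  by apply: eq_integral => z _; rewrite /F [in LHS]mevalM.
rewrite /cone_ip; move: (b_cone d p q mu) ipE => b ipE.
transitivity (b%:E * \int[lebt d \x leb]_(z in @cone_set R d)
    \sum_i ((c i)%:E * (EFin \o F (kk i)) z))%E.
  congr (_ * _)%E; apply: eq_integral => z _.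
  rewrite /= (eq_bigr (fun i => (c i * F (kk i) z)%:E)) ?sumEFin//; congr EFin.
  rewrite raddf_sum/= mulr_suml mulr_suml; apply: eq_bigr => i _.
  by rewrite /F mevalZ [in RHS]mevalM !mulrA.
rewrite integral_sum//; last 2 first.
- exact: measurable_cone_set.
- by move=> i; apply: integrableZl; [exact: measurable_cone_set|exact: intF].
pose J i := fine (\int[lebt d \x leb]_(z in @cone_set R d) (F (kk i) z)%:E)%E.
have JE i : (\int[lebt d \x leb]_(z in @cone_set R d) (EFin \o F (kk i)) z)%E = (J i)%:E.
  rewrite /J fineK//; apply: integrable_fin_num; [exact: measurable_cone_set|exact: intF].
rewrite (eq_bigr (fun i => (c i * J i)%:E)); last first.
  by move=> i _; rewrite integralZl ?JE//; [exact: measurable_cone_set|exact: intF].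
rewrite sumEFin -EFinM; congr EFin; rewrite mulr_sumr; apply: eq_bigr => i _.
have bJ : b * J i = cone_norm k' * (kk i == k')%:R.
  by apply: EFin_inj; rewrite EFinM -JE; exact: ipE.
by rewrite mulrCA bJ.
Qed.

(** Pairing the relation with one member of the family isolates its coefficient times a positive
    norm. *)
Lemma cone_poly_free (I : finType) (kk : I -> multinom d.+1) (c : I -> R) :
  injective kk -> (forall i, (mdeg (kk i) <= N)%N) ->
  \sum_i c i *: cone_poly (kk i) = 0 -> forall i, c i = 0.
Proof.
move=> inj_kk kN c0 i.
have ip0 : ip 0 (cone_poly (kk i)) = 0%E.
  rewrite /cone_ip integral0_eq ?mule0// => z _.
  by rewrite meval0 !mul0r.
have E : 0 = \sum_j c j * (cone_norm (kk i) * (kk j == kk i)%:R).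
  by apply: EFin_inj; rewrite -(cone_ip_sum c kN (kN i)) c0 ip0.
have n0 := cone_norm_gt0 (kN i); move: (cone_norm _) n0 E => h n0.
rewrite (bigD1 i)//= big1 => [|j ji]; last first.
  by rewrite (inj_eq inj_kk) (negbTE ji) !mulr0.
rewrite eqxx mulr1 addr0 => /esym/eqP; rewrite mulf_eq0 (gt_eqF n0) orbF.
by move/eqP.
Qed.

(** The [cone_poly k] with [|k| < r] are indexed by the same set as the monomials of degree below
    [r], so their coefficient matrix is square; independence makes it invertible. *)
Lemma cone_poly_span r (g : {mpoly R[d.+1]}) : (r <= N.+1)%N -> (msize g <= r)%N ->
  exists c : bmultinom d.+1 r -> R, g = \sum_k c k *: cone_poly k.
Proof.
move=> rN gr.
pose T := bmultinom d.+1 r.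
have bmN (k : T) : (mdeg k <= N)%N.
  by rewrite -ltnS (leq_trans (bmdeg k)).
have sz (k : T) : (msize (cone_poly k) <= r)%N.
  by rewrite (leq_trans (msize_coneM (mdeg_front_le k)))// bmdeg.
pose A : 'M[R]_#|{: T}| := \matrix_(i, j) mcoeff (enum_val j : T) (cone_poly (enum_val i : T)).
(* Multiplication by [A] converts coordinates along the [cone_poly k] into coordinates along the
   monomials. *)
have lin (v : 'rV[R]_#|{: T}|) :
    \sum_(k : T) v 0 (enum_rank k) *: cone_poly k =
    \sum_(j : T) (v *m A) 0 (enum_rank j) *: mpolyX R j.
  under eq_bigr do rewrite (mpolywE (sz _)) scaler_sumr.
  rewrite exchange_big; apply: eq_bigr => j _ /=.
  under eq_bigr do rewrite scalerA.
  rewrite -scaler_suml; congr (_ *: _).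
  rewrite mxE (reindex_onto (@enum_rank T) (@enum_val T predT))/=; last first.
    by move=> i _; rewrite enum_valK.
  apply: eq_big => [k|k _]; first by rewrite enum_rankK eqxx.
  by rewrite mxE !enum_rankK.
have Au : A \in unitmx.
  rewrite -row_free_unit; apply: inj_row_free => v vA0.
  apply/rowP => i; rewrite mxE.
  have := @cone_poly_free T (@bmnm _ _) (fun k => v 0 (enum_rank k)) val_inj bmN.
  rewrite lin vA0 big1 => [|k _]; last by rewrite mxE scale0r.
  by move=> /(_ erefl (enum_val i)); rewrite enum_valK.
pose u : 'rV[R]_#|{: T}| := \row_j mcoeff (enum_val j : T) g.
exists (fun k => (u *m invmx A) 0 (enum_rank k)).
rewrite lin mulmxKV// [LHS](mpolywE gr); apply: eq_bigr => k _.
by rewrite mxE enum_rankK.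
Qed.

(** Inverse to [mnm_front] between exponents of degree at most [n] in [x] and exponents of degree
    exactly [n] in [(x, t)]; the truncated subtraction is exact in that range. *)
Definition mnm_lift n (k : multinom d) : multinom d.+1 :=
  Multinom [tuple of rcons k (n - mdeg k)%N].

Lemma mnm_lift_max n k : mnm_lift n k ord_max = (n - mdeg k)%N.
Proof. by rewrite multinomE (tnth_nth 0%N) /= nth_rcons size_tuple ltnn eqxx. Qed.

Lemma mnm_front_lift n k : mnm_front (mnm_lift n k) = k.
Proof.
apply/mnmP => i; rewrite multinomE tnth_mktuple multinomE mnm_tnth.
by rewrite !(tnth_nth 0%N)/= nth_rcons size_tuple ltn_ord.
Qed.

Lemma mdeg_lift n k : (mdeg k <= n)%N -> mdeg (mnm_lift n k) = n.
Proof. by move=> kn; rewrite mdeg_front mnm_front_lift mnm_lift_max subnKC. Qed.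

Lemma mnm_lift_inj n : injective (mnm_lift n).
Proof. by move=> k k' /(congr1 mnm_front); rewrite !mnm_front_lift. Qed.

Lemma mnm_frontK n (k : multinom d.+1) : mdeg k = n -> mnm_lift n (mnm_front k) = k.
Proof.
move=> <-; apply: mnm_front_inj; last exact: mnm_front_lift.
by rewrite mdeg_lift// mdeg_front_le.
Qed.

Lemma coneM_cone_poly n k : (mdeg k <= n)%N -> coneP n k = cone_poly (mnm_lift n k).
Proof. by move=> kn; rewrite /cone_poly mdeg_lift// mnm_front_lift. Qed.

Section degree.
Variable n : nat.
Hypothesis nN : (n <= N)%N.

Let bmn (k : bmultinom d n.+1) : (mdeg k <= n)%N.
Proof. by rewrite -ltnS bmdeg. Qed.

(** A polynomial of [msize] at most [n] has degree below [n], hence is a combination of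
    [cone_poly i] with [|i| < n]. None of these indices equals [mnm_lift n k], whose degree is
    [n]. *)
Lemma coneM_space k : (mdeg k <= n)%N -> orthopoly_space ip n (coneP n k).
Proof.
move=> kn; split; first exact: msize_coneM.
move=> g gn; have [|c ->] := cone_poly_span _ gn; first exact: leq_trans nN _.
rewrite cone_ipC coneM_cone_poly// cone_ip_sum ?mdeg_lift//; last first.
  by move=> i; rewrite (leq_trans _ nN)// ltnW// bmdeg.
rewrite big1// => i _; rewrite (_ : _ == _ = false) ?mulr0//.
apply/eqP => e; have := bmdeg i.
by rewrite e mdeg_lift// ltnn.
Qed.

(** Independence and orthogonality come from the whole family through [mnm_lift]. For spanning, [f]
    is expanded along all [cone_poly k] of degree at most [n], and only those with [|k| = n]
    survive. *)
Lemma coneM_basis :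
  is_orthogonal_basis ip (fun k : bmultinom d n.+1 => true)
    (fun k : bmultinom d n.+1 => coneP n k) (orthopoly_space ip n).
Proof.
have liftN (k : bmultinom d n.+1) : (mdeg (mnm_lift n k) <= N)%N by rewrite mdeg_lift.
split; last first.
  move=> i j _ _ ij; rewrite !coneM_cone_poly// cone_ip_cone_poly//.
  by rewrite (inj_eq (@mnm_lift_inj n)) -bmeqP (negbTE ij) mulr0.
split=> [k _|c c0 k _|f [fn fo]].
- exact: coneM_space.
- apply: (@cone_poly_free _ (fun k : bmultinom d n.+1 => mnm_lift n k) c) => //.
    by move=> i j /mnm_lift_inj; exact: val_inj.
  by rewrite -[RHS]c0; apply: eq_bigr => i _; rewrite coneM_cone_poly.
have [|c fE] := cone_poly_span _ fn; first by rewrite ltnS.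
have bmN (i : bmultinom d.+1 n.+1) : (mdeg i <= N)%N.
  by rewrite -ltnS (leq_trans (bmdeg i)).
(* For [|k| < n] the polynomial [cone_poly k] has degree below [n], so [f] is orthogonal to it; the
   same pairing equals [c k] times a positive norm. *)
have c0 (k : bmultinom d.+1 n.+1) : mdeg k != n -> c k = 0.
  move=> kn; have kn' : (mdeg k < n)%N by rewrite ltn_neqAle kn -ltnS bmdeg.
  have sk : (msize (cone_poly k) <= n)%N.
    by rewrite (leq_trans (msize_coneM (mdeg_front_le k))).
  have E : 0 = \sum_i c i * (cone_norm k * ((i : multinom d.+1) == k)%:R).
    by apply: EFin_inj; rewrite -(cone_ip_sum c bmN (bmN k)) -fE fo.
  have n0 := cone_norm_gt0 (bmN k); move: (cone_norm _) n0 E => h n0.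
  rewrite (bigD1 k)//= big1 => [|j jk]; last first.
    by rewrite -bmeqP (negbTE jk) !mulr0.
  rewrite eqxx mulr1 addr0 => /esym/eqP; rewrite mulf_eq0 (gt_eqF n0) orbF.
  by move/eqP.
have liftn (k : bmultinom d n.+1) : (mdeg (mnm_lift n k) < n.+1)%N by rewrite mdeg_lift.
have frontn (k : bmultinom d.+1 n.+1) : (mdeg (mnm_front k) < n.+1)%N.
  by rewrite (leq_ltn_trans (mdeg_front_le k))// bmdeg.
exists (fun k => c (BMultinom (liftn k))); rewrite fE.
rewrite (bigID (fun k : bmultinom d.+1 n.+1 => mdeg k == n))/= [X in _ + X]big1 ?addr0; last first.
  by move=> k kn; rewrite c0// scale0r.
(* The surviving exponents of degree [n] correspond to the exponents of degree at most [n] in [d]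
   variables through [mnm_lift] and [mnm_front]. *)
rewrite (reindex_onto (fun k : bmultinom d n.+1 => BMultinom (liftn k))
  (fun k : bmultinom d.+1 n.+1 => BMultinom (frontn k)))/=; last first.
  by move=> k /eqP kn; apply: val_inj; rewrite /= mnm_frontK.
apply: eq_big => [k|k _].
  by rewrite mdeg_lift// eqxx /=; apply/eqP/val_inj; rewrite /= mnm_front_lift.
by rewrite coneM_cone_poly.
Qed.

End degree.

End cone_basis.

Theorem proposition3p1 (R : realType) (d n n' : nat) (mu p q : R)
    (P : multinom d -> {mpoly R[d]}) :
  (1 <= d)%N ->
  - 2^-1 < mu ->
  2 * (maxn n n')%:R + 2 * mu + d%:R < p ->
  - 2 * mu - d%:R < q ->
  (forall m : nat,
     is_orthonormal_basis (@ball_ip R d mu)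
       (fun k : bmultinom d m.+1 => mdeg k == m)
       (fun k : bmultinom d m.+1 => P k)
       (orthopoly_space (@ball_ip R d mu) m)) ->
  is_orthogonal_basis (@cone_ip R d p q mu)
    (fun k : bmultinom d n.+1 => true)
    (fun k : bmultinom d n.+1 => coneM p q mu P n k)
    (orthopoly_space (@cone_ip R d p q mu) n) /\
  (forall (m m' : nat) (k k' : multinom d),
     mdeg k = m -> (m <= n)%N -> mdeg k' = m' -> (m' <= n')%N ->
     cone_ip p q mu (coneM p q mu P n k) (coneM p q mu P n' k') =
     (H_ d p q mu m n * (n == n')%:R * (m == m')%:R * (k == k')%:R)%:E).
Proof.
move=> _ _ np q0 orthoP; split.
  (* The degree bound [N] of the counting argument is taken to be [maxn n n']. *)
  by apply: (coneM_basis orthoP np q0); rewrite leq_maxl.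
move=> _ _ k k' <- kn <- kn'; rewrite (cone_ip_coneM orthoP np q0)//; congr EFin.
(* Equal multi-indices have equal degrees, so the delta in [m] is implied by the delta in [k]. *)
have [->|_] := eqVneq k k'; last by rewrite !mulr0.
by rewrite eqxx !mulr1.
Qed.
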